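(* Let $\Omega\subset\mathbb R^2$, let $\beta\in\mathcal C^\infty(\Omega)$, let $G\in\Omega$, and let $N\in\mathbb C$ with $N\neq 0$. Suppose that $n\in\mathbb N$, $n\ge 1$, and that $u\in\mathcal C^{n+1}(\Omega)$ is a solution of the scalar wave equation $-\Delta u+\beta u=0$ in $\Omega$. Let $q\in\mathbb N$ with $q\geq n+1$, let $p=2n+1$, and let $\mathcal E(G,N,p,q)=\{\varphi_l\}_{1\le l\le p}$ be the set of generalized plane waves at $G$ with parameter $N$ and approximation order $q$ defined in the context. Then there are a function $u_a\in \mathrm{Span}\,\mathcal E(G,N,p,q)$ depending on $\beta$ and $n$, and a constant $C_{N,\Omega}$ depending on $N$, $\beta$ and $n$, such that for all $M\in\Omega$ $$\left| u(M)-u_a(M)\right| \leq C_{N,\Omega}\, |M-G|^{n+1} \left\| u \right\|_{\mathcal C^{n+1}(\Omega)},$$ $$\left\| \nabla u(M)-\nabla u_a(M)\right\| \leq C_{N,\Omega}\, |M-G|^{n} \left\| u \right\|_{\mathcal C^{n+1}(\Omega)}.$$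
   Context: Write $G=(x_G,y_G)$. $\|\cdot\|_{\mathcal C^{n+1}(\Omega)}$ is the usual $\mathcal C^{n+1}$ norm on $\Omega$ (sup norm of the function and its partial derivatives of order at most $n+1$). Generalized plane wave. Given $q\ge 1$, $\theta\in\mathbb R$ and $N\in\mathbb C\setminus\{0\}$, the generalized plane wave at $G$ is $\varphi=e^P$ with $$P(x,y)=\sum_{i,j\ge 0,\ i+j\leq q+1} \lambda_{i,j}\,(x-x_G)^i (y-y_G)^j,$$ whose complex coefficients are defined by: (1) $(\lambda_{1,0},\lambda_{0,1})=N(\cos\theta,\sin\theta)$; (2) $\lambda_{0,0}=0$; (3) $\lambda_{i,j}=0$ for $i\in\{0,1\}$ and $1<i+j\leq q+1$; (4) for all $i,j\ge0$ with $0\leq i+j\leq q-1$, by induction on $i$, $$\lambda_{i+2,j}=\frac1{(i+2)(i+1)}\Bigg(\frac{\partial_x^i\partial_y^j\beta(G)}{i!\,j!}-(j+2)(j+1)\lambda_{i,j+2}-\sum_{k=0}^{i}\sum_{l=0}^{j}(i-k+1)(k+1)\lambda_{i-k+1,j-l}\lambda_{k+1,l}-\sum_{k=0}^{j}\sum_{l=0}^{i}(j-k+1)(k+1)\lambda_{i-l,j-k+1}\lambda_{l,k+1}\Bigg).$$ The set $\mathcal E(G,N,p,q)$. For an integer $p\ge 3$ and $1\le l\le p$, let $\theta_l=2\pi(l-1)/p$ and let $\varphi_l$ be the generalized plane wave with parameters $q$, $N$ and $\theta=\theta_l$. Then $\mathcal E(G,N,p,q)=\{\varphi_l\}_{1\le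 l\le p}$.
   Formalization: Ω is assumed open and bounded: for Ω=R², β=0, u=1, n=1, N=i, q=2 the estimates fail since u_a grows exponentially; the constant is independent of u but may depend on Ω, G and q as well as on N, β and n. *)

(* Defs.v *)
From Stdlib Require Import Reals Arith Lia.
From Coquelicot Require Import Coquelicot.
Open Scope R_scope.

(** Functions on a subset [Omega] of the plane are represented by total
    functions [R -> R -> C]. [Omega] is always open below, so continuity and
    derivatives at a point of [Omega] only involve the values on [Omega]. *)

Definition bounded2 (Omega : R * R -> Prop) : Prop :=
  exists B : R, forall M, Omega M -> dist_euc 0 0 (fst M) (snd M) <= B.

(** [∂_x^i ∂_y^j f (x, y)], the real and imaginary parts being differentiated
    separately. *)
Definition pderiv (i j : nat) (f : R -> R -> C) (x y : R) : C :=
  (partial_derive i j (fun s t => Re (f s t)) x y,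
   partial_derive i j (fun s t => Im (f s t)) x y).

(** Coquelicot's [ex_diff_n f k x y] says that the partial derivatives of [f]
    of order at most [k], mixed ones in any order, exist and are continuous at
    [(x, y)]. *)
Definition Ck_on (k : nat) (Omega : R * R -> Prop) (f : R -> R -> C) : Prop :=
  forall x y, Omega (x, y) ->
    ex_diff_n (fun s t => Re (f s t)) k x y /\
    ex_diff_n (fun s t => Im (f s t)) k x y.

Definition Cinf_on (Omega : R * R -> Prop) (f : R -> R -> C) : Prop :=
  forall k, Ck_on k Omega f.

(** The norm takes values in [Rbar]: derivatives of a function of class [C^k]
    on an open set may be unbounded. *)
Definition Ck_norm (k : nat) (Omega : R * R -> Prop) (f : R -> R -> C) : Rbar :=
  Lub_Rbar (fun r => exists (i j : nat) (x y : R),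
    (i + j <= k)%nat /\ Omega (x, y) /\ r = Cmod (pderiv i j f x y)).

Definition laplacian (f : R -> R -> C) (x y : R) : C :=
  (pderiv 2 0 f x y + pderiv 0 2 f x y)%C.

(** [‖∇f(x, y) - ∇g(x, y)‖], Hermitian norm on [C^2]. *)
Definition grad_dist (f g : R -> R -> C) (x y : R) : R :=
  sqrt (Cmod (pderiv 1 0 f x y - pderiv 1 0 g x y) ^ 2
        + Cmod (pderiv 0 1 f x y - pderiv 0 1 g x y) ^ 2).

Definition Cexp (z : C) : C :=
  (exp (Re z) * cos (Im z), exp (Re z) * sin (Im z)).

Definition NtoC (k : nat) : C := RtoC (INR k).

Section GeneralizedPlaneWave.

Variables (beta : R -> R -> C) (G : R * R) (N : C) (theta : R).

(** Right-hand side of the induction formula for [λ_{i+2,j}]. *)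
Definition gpw_step (lam : nat -> nat -> C) (i j : nat) : C :=
  ((pderiv i j beta (fst G) (snd G) / (NtoC (fact i) * NtoC (fact j))
    - NtoC (j + 2) * NtoC (j + 1) * lam i (j + 2)%nat
    - sum_n (fun k => sum_n (fun l =>
        NtoC (i - k + 1) * NtoC (k + 1)
        * lam (i - k + 1)%nat (j - l)%nat * lam (k + 1)%nat l) j) i
    - sum_n (fun k => sum_n (fun l =>
        NtoC (j - k + 1) * NtoC (k + 1)
        * lam (i - l)%nat (j - k + 1)%nat * lam l (k + 1)%nat) i) j)
   / (NtoC (i + 2) * NtoC (i + 1)))%C.

(** [gpw_rows m i j] is [λ_{i,j}] for [i <= m + 1]. *)
Fixpoint gpw_rows (m : nat) : nat -> nat -> C :=
  match m with
  | O => fun i j =>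
      match i, j with
      | 1%nat, 0%nat => (N * RtoC (cos theta))%C
      | 0%nat, 1%nat => (N * RtoC (sin theta))%C
      | _, _ => RtoC 0
      end
  | S m' => fun i j =>
      if Nat.eq_dec i (m' + 2) then gpw_step (gpw_rows m') m' j
      else gpw_rows m' i j
  end.

(** The values with [i + j <= q + 1] do not depend on [q]; those with
    [i + j > q + 1] do not occur in [gpw_phase]. *)
Definition gpw_coeff (i j : nat) : C := gpw_rows i i j.

Definition gpw_phase (q : nat) (x y : R) : C :=
  sum_n (fun i => sum_n (fun j =>
    (gpw_coeff i j * RtoC ((x - fst G) ^ i * (y - snd G) ^ j))%C)
    (q + 1 - i)) (q + 1).

Definition gpw (q : nat) (x y : R) : C := Cexp (gpw_phase q x y).

Lemma gpw_rows_coeff m i j :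
  (i <= m + 1)%nat -> gpw_rows m i j = gpw_coeff i j.
Proof.
assert (stab : forall d k, (k <= d + 1)%nat ->
          gpw_rows (S d) k j = gpw_rows d k j).
{ intros d k Hk; simpl; destruct (Nat.eq_dec k (d + 2)); [lia | easy]. }
assert (up : forall d k, gpw_rows (k + d) k j = gpw_rows k k j).
{ induction d as [|d IH]; intros k.
  - now rewrite Nat.add_0_r.
  - rewrite Nat.add_succ_r, stab by lia; apply IH. }
intros Hi; unfold gpw_coeff; destruct (Nat.le_gt_cases i m) as [H|H].
- replace m with (i + (m - i))%nat by lia; apply up.
- replace i with (S m) by lia; symmetry; apply stab; lia.
Qed.

Lemma gpw_coeff_spec :
  (gpw_coeff 1 0 = (N * RtoC (cos theta))%C
   /\ gpw_coeff 0 1 = (N * RtoC (sin theta))%C)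
  /\ gpw_coeff 0 0 = RtoC 0
  /\ (forall i j, (i <= 1)%nat -> (1 < i + j)%nat -> gpw_coeff i j = RtoC 0)
  /\ (forall i j, gpw_coeff (i + 2) j = gpw_step gpw_coeff i j).
Proof.
split; [easy | split; [easy | split]].
- intros i j Hi Hij; rewrite <- (gpw_rows_coeff 0) by lia.
  destruct i as [|[|i]]; destruct j as [|[|j]]; simpl; easy || lia.
- intros i j; rewrite <- (gpw_rows_coeff (S i)) by lia; simpl.
  destruct (Nat.eq_dec (i + 2) (i + 2)) as [_|E]; [|easy].
  unfold gpw_step; rewrite (gpw_rows_coeff i i) by lia.
  apply (f_equal (fun z => (z / (NtoC (i + 2) * NtoC (i + 1)))%C)).
  apply (f_equal2 Cminus); [apply (f_equal2 Cminus); [easy |] |];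
    apply sum_n_ext_loc; intros k Hk; apply sum_n_ext_loc; intros l Hl;
    rewrite !(gpw_rows_coeff i) by lia; reflexivity.
Qed.

End GeneralizedPlaneWave.

Definition gpw_angle (p l : nat) : R := 2 * PI * INR (l - 1) / INR p.

(** [E(G, N, p, q)], as the family of the [φ_l], [1 <= l <= p]. *)
Definition gpw_family (beta : R -> R -> C) (G : R * R) (N : C) (p q l : nat) :
    R -> R -> C :=
  gpw beta G N (gpw_angle p l) q.

(** The complex linear span of [φ_1, ..., φ_p]. *)
Definition in_span (p : nat) (phi : nat -> R -> R -> C) (f : R -> R -> C) :
    Prop :=
  exists a : nat -> C, forall x y,
    f x y = sum_n_m (fun l => (a l * phi l x y)%C) 1 p.

(* Main.v *)
Require Import Defs.
From Stdlib Require Import Reals Arith ZArith Lia Lra.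
From Coquelicot Require Import Coquelicot.
From mathcomp Require all_boot all_algebra Rstruct zify.
Open Scope R_scope.

(** By the choice of its coefficients, a generalized plane wave [phi] solves the
    equation up to a remainder vanishing to order [q - 1] at [G]. The equation
    determines the Taylor coefficients of order at most [n] of a solution from
    those of [f (x_G, .)] and [d_x f (x_G, .)], that is, from [2 n + 1] numbers.
    Since [lambda_{0,j} = 0] and [lambda_{1,j} = 0] except for the linear terms,
    for [phi] these are [(N sin theta)^j] and [N cos theta (N sin theta)^j]; so
    matching them with those of [u] is an interpolation problem for
    trigonometric polynomials of degree [n] at [2 n + 1] distinct angles.
    Such a polynomial is [A (sin) + cos * B (sin)], and the equidistant angles
    have distinct sines because [2 n + 1] is odd; if it vanishes at all of them
    then [A^2 - (1 - X^2) B^2], of degree at most [2 n], has [2 n + 1] roots, and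
    [A^2 = (1 - X^2) B^2] forces [A = B = 0]. Taylor's inequality for [u - u_a]
    near [G], and boundedness of [Omega] away from [G], give the estimates. *)

(** * Functions of class [C^k] on an open subset of the plane *)

(** The constant has to be fixed before [u], while [u_a] depends on [u]. The weights of [u_a] depend
    linearly on the derivatives of [u] at [G], through an inverse matrix fixed by [n] and by powers
    of [N]; so they are at most a fixed multiple of the norm of [u], and so are the derivatives of
    [u - u_a] up to order n + 1. [Omega] is not assumed convex, so a path from [G] to a point may
    leave it: Taylor's inequality is confined to a square around [G], outside of which the distance
    to [G] is bounded below. The norm of [u] may be [p_infty]. At [G] the right-hand sides are then
    0 times infinity, which is 0 in [Rbar], so the equality of values and gradients at [G] is kept
    as a separate conclusion. Finally [u] has only n + 1 derivatives while the waves are smooth. Two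
    calculi coexist: normalized coefficients [T] for smooth functions, where products are
    convolutions, and plain derivatives [DD] for [u]. *)

Lemma C_eq (z w : C) : Re z = Re w -> Im z = Im w -> z = w.
Proof. destruct z, w; simpl; now intros -> ->. Qed.

Definition is_CDerive (g : R -> C) (t : R) (l : C) : Prop :=
  is_derive (fun s => Re (g s)) t (Re l) /\
  is_derive (fun s => Im (g s)) t (Im l).

Definition CDerive (g : R -> C) (t : R) : C :=
  (Derive (fun s => Re (g s)) t, Derive (fun s => Im (g s)) t).

Lemma is_CDerive_unique g t l : is_CDerive g t l -> CDerive g t = l.
Proof.
intros [H1 H2]; apply C_eq; simpl; now apply is_derive_unique.
Qed.

Lemma is_CDerive_ext_loc f g t l :
  locally t (fun s => f s = g s) -> is_CDerive f t l -> is_CDerive g t l.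
Proof.
intros E [H1 H2]; split;
  [apply (is_derive_ext_loc (fun s => Re (f s))) |
   apply (is_derive_ext_loc (fun s => Im (f s)))]; auto;
  apply filter_imp with (2 := E); now intros s ->.
Qed.

Lemma CDerive_ext_loc f g t :
  locally t (fun s => f s = g s) -> CDerive f t = CDerive g t.
Proof.
intros E; apply C_eq; simpl; apply Derive_ext_loc;
  apply filter_imp with (2 := E); now intros s ->.
Qed.

Lemma is_CDerive_const (c : C) t : is_CDerive (fun _ => c) t (RtoC 0).
Proof. split; apply (is_derive_const (V := R_NormedModule)). Qed.

Lemma is_CDerive_plus f g t l m :
  is_CDerive f t l -> is_CDerive g t m ->
  is_CDerive (fun s => (f s + g s)%C) t (l + m)%C.
Proof.
intros [H1 H2] [H3 H4]; split.
- now apply (is_derive_plus (V := R_NormedModule)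
    (fun s => Re (f s)) (fun s => Re (g s))).
- now apply (is_derive_plus (V := R_NormedModule)
    (fun s => Im (f s)) (fun s => Im (g s))).
Qed.

Lemma is_CDerive_mult f g t l m :
  is_CDerive f t l -> is_CDerive g t m ->
  is_CDerive (fun s => (f s * g s)%C) t (l * g t + f t * m)%C.
Proof.
assert (P : forall (a b : R -> R) a' b', is_derive a t a' -> is_derive b t b' ->
  is_derive (fun s => a s * b s) t (a' * b t + a t * b')).
{ intros a b a' b' Ha Hb; apply (is_derive_mult a b); auto.
  intros; apply Rmult_comm. }
intros [H1 H2] [H3 H4]; split.
- evar_last.
  + apply (is_derive_minus (V := R_NormedModule) _ _ _ _ _
      (P _ _ _ _ H1 H3) (P _ _ _ _ H2 H4)).
  + unfold minus, plus, opp; simpl; unfold Re, Im; ring.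
- evar_last.
  + apply (is_derive_plus (V := R_NormedModule) _ _ _ _ _
      (P _ _ _ _ H1 H4) (P _ _ _ _ H2 H3)).
  + unfold plus; simpl; unfold Re, Im; ring.
Qed.

Lemma is_CDerive_Cexp f t l :
  is_CDerive f t l -> is_CDerive (fun s => Cexp (f s)) t (l * Cexp (f t))%C.
Proof.
assert (P : forall (a b : R -> R) a' b', is_derive a t a' -> is_derive b t b' ->
  is_derive (fun s => exp (a s) * cos (b s)) t
    (a' * (exp (a t) * cos (b t)) - b' * (exp (a t) * sin (b t))) /\
  is_derive (fun s => exp (a s) * sin (b s)) t
    (a' * (exp (a t) * sin (b t)) + b' * (exp (a t) * cos (b t)))).
{ intros a b a' b' Ha Hb; split;
    (auto_derive; [repeat split; eexists; eassumption|]);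
    change (Derive (fun s => a s) t) with (Derive a t);
    change (Derive (fun s => b s) t) with (Derive b t);
    rewrite (is_derive_unique a _ _ Ha), (is_derive_unique b _ _ Hb); ring. }
intros [H1 H2]; destruct (P _ _ _ _ H1 H2); now split.
Qed.

Definition Ccont (f : R -> R -> C) (x y : R) : Prop :=
  continuity_2d_pt (fun s t => Re (f s t)) x y /\
  continuity_2d_pt (fun s t => Im (f s t)) x y.

(** [true] is the direction of [x], [false] that of [y]. *)
Definition slice (b : bool) (f : R -> R -> C) (x y : R) : R -> C :=
  if b then fun s => f s y else fun s => f x s.

Definition coord (b : bool) (x y : R) : R := if b then x else y.

Definition dd (b : bool) (f : R -> R -> C) (x y : R) : C :=
  CDerive (slice b f x y) (coord b x y).

Definition is_dd b f x y l := is_CDerive (slice b f x y) (coord b x y) l.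

Lemma is_dd_unique b f x y l : is_dd b f x y l -> dd b f x y = l.
Proof. apply is_CDerive_unique. Qed.

(** The recursion passes through the first derivatives in both directions, so that closure under
    products and exponentials is an induction on [k]. Since [dd] is a total function,
    differentiability is recorded as [is_dd] at that value. *)
Fixpoint Cdiff (Om : R * R -> Prop) (k : nat) (f : R -> R -> C) : Prop :=
  (forall x y, Om (x, y) -> Ccont f x y) /\
  match k with
  | O => True
  | S k' => forall b, (forall x y, Om (x, y) -> is_dd b f x y (dd b f x y)) /\
                      Cdiff Om k' (dd b f)
  end.

Lemma Ck_on_Cdiff Om k f : Ck_on k Om f -> Cdiff Om k f.
Proof.
revert f; induction k as [|k IH]; intros f H.
- split; [|exact I]; intros x y Hxy; destruct (H x y Hxy) as [[H1 _] [H2 _]].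
  now split.
- split.
  { intros x y Hxy; destruct (H x y Hxy) as [[H1 _] [H2 _]]; now split. }
  intros b; split.
  + intros x y Hxy; destruct (H x y Hxy) as [[_ [H1 [H2 _]]] [_ [H3 [H4 _]]]].
    destruct b; split; now apply Derive_correct.
  + apply IH; intros x y Hxy.
    destruct (H x y Hxy) as [[_ [_ [_ [H1 H2]]]] [_ [_ [_ [H3 H4]]]]].
    destruct b; now split.
Qed.

Lemma Cdiff_cont Om k f x y : Cdiff Om k f -> Om (x, y) -> Ccont f x y.
Proof. destruct k; intros [H _]; apply H. Qed.

Lemma Cdiff_dd Om k b f : Cdiff Om (S k) f -> Cdiff Om k (dd b f).
Proof. intros [_ H]; apply (H b). Qed.

Lemma Cdiff_is_dd Om k b f x y :
  Cdiff Om (S k) f -> Om (x, y) -> is_dd b f x y (dd b f x y).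
Proof. intros [_ H]; apply (H b). Qed.

Lemma Cdiff_S Om k f : Cdiff Om (S k) f -> Cdiff Om k f.
Proof.
revert f; induction k as [|k IH]; intros f [H1 H2]; split; auto.
intros b; destruct (H2 b) as [H3 H4]; split; auto.
Qed.

Lemma Cdiff_le Om k m f : (k <= m)%nat -> Cdiff Om m f -> Cdiff Om k f.
Proof.
intros H; induction H; [easy|]; intros; now apply IHle, Cdiff_S.
Qed.

Section Domain.

Variables (Om : R * R -> Prop) (Om_open : open Om).

Lemma open_2d x y : Om (x, y) -> locally_2d (fun s t => Om (s, t)) x y.
Proof.
intros H; apply locally_2d_locally.
apply filter_imp with (2 := Om_open _ H); now intros [s t].
Qed.

Definition eq_on (f g : R -> R -> C) : Prop :=
  forall x y, Om (x, y) -> f x y = g x y.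

Lemma slice_eq_on b f g x y : eq_on f g -> Om (x, y) ->
  locally (coord b x y) (fun s => slice b f x y s = slice b g x y s).
Proof.
intros E H; apply open_2d in H; destruct b; simpl.
- apply locally_2d_1d_const_y in H; apply filter_imp with (2 := H); auto.
- apply locally_2d_1d_const_x in H; apply filter_imp with (2 := H); auto.
Qed.

Lemma is_dd_ext b f g x y l : eq_on f g -> Om (x, y) ->
  is_dd b f x y l -> is_dd b g x y l.
Proof. intros E H; apply is_CDerive_ext_loc; now apply slice_eq_on. Qed.

Lemma dd_ext b f g : eq_on f g -> eq_on (dd b f) (dd b g).
Proof. intros E x y H; apply CDerive_ext_loc; now apply slice_eq_on. Qed.

Lemma Ccont_ext f g x y : eq_on f g -> Om (x, y) -> Ccont f x y -> Ccont g x y.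
Proof.
intros E H [H1 H2]; apply open_2d in H; split;
 [apply (continuity_2d_pt_ext_loc (fun s t => Re (f s t)))
 |apply (continuity_2d_pt_ext_loc (fun s t => Im (f s t)))]; auto;
 apply locally_2d_impl with (2 := H); apply locally_2d_forall;
 intros u v Huv; now rewrite E.
Qed.

Lemma Cdiff_ext k f g : eq_on f g -> Cdiff Om k f -> Cdiff Om k g.
Proof.
revert f g; induction k as [|k IH]; intros f g E [H1 H2]; split; auto;
  try (intros x y Hxy; apply (Ccont_ext f); now auto).
intros b; destruct (H2 b) as [H3 H4]; split.
- intros x y Hxy; rewrite <- (dd_ext b f g E x y Hxy).
  apply (is_dd_ext b f g); auto.
- apply (IH (dd b f)); [now apply dd_ext | easy].
Qed.

(** Induction step for closure properties: it suffices to exhibit the partial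
    derivatives up to equality on [Om]. *)
Lemma Cdiff_intro k f (df : bool -> R -> R -> C) :
  (forall x y, Om (x, y) -> Ccont f x y) ->
  (forall b x y, Om (x, y) -> is_dd b f x y (df b x y)) ->
  (forall b, Cdiff Om k (df b)) -> Cdiff Om (S k) f.
Proof.
intros H1 H2 H3; split; [easy|]; intros b.
assert (E : eq_on (df b) (dd b f)).
{ intros x y H; symmetry; now apply is_dd_unique, H2. }
split.
- intros x y H; rewrite <- (E x y H); auto.
- now apply (Cdiff_ext k (df b)).
Qed.

Lemma is_dd_plus b f g x y l m : is_dd b f x y l -> is_dd b g x y m ->
  is_dd b (fun s t => (f s t + g s t)%C) x y (l + m)%C.
Proof. destruct b; apply is_CDerive_plus. Qed.

Lemma is_dd_mult b f g x y l m : is_dd b f x y l -> is_dd b g x y m ->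
  is_dd b (fun s t => (f s t * g s t)%C) x y (l * g x y + f x y * m)%C.
Proof. destruct b; apply is_CDerive_mult. Qed.

Lemma is_dd_Cexp b f x y l : is_dd b f x y l ->
  is_dd b (fun s t => Cexp (f s t)) x y (l * Cexp (f x y))%C.
Proof. destruct b; apply is_CDerive_Cexp. Qed.

Lemma is_dd_const b c x y : is_dd b (fun _ _ => c) x y (RtoC 0).
Proof. destruct b; apply is_CDerive_const. Qed.

Lemma Ccont_plus f g x y : Ccont f x y -> Ccont g x y ->
  Ccont (fun s t => (f s t + g s t)%C) x y.
Proof. intros [H1 H2] [H3 H4]; split; now apply continuity_2d_pt_plus. Qed.

Lemma Ccont_mult f g x y : Ccont f x y -> Ccont g x y ->
  Ccont (fun s t => (f s t * g s t)%C) x y.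
Proof.
intros [H1 H2] [H3 H4]; split; simpl.
- apply continuity_2d_pt_minus; now apply continuity_2d_pt_mult.
- apply continuity_2d_pt_plus; now apply continuity_2d_pt_mult.
Qed.

Lemma Ccont_Cexp f x y : Ccont f x y -> Ccont (fun s t => Cexp (f s t)) x y.
Proof.
intros [H1 H2]; split; unfold Cexp; simpl; apply continuity_2d_pt_mult;
  apply continuity_1d_2d_pt_comp; auto;
  apply derivable_continuous_pt;
  (apply derivable_pt_exp || apply derivable_pt_cos || apply derivable_pt_sin).
Qed.

Lemma Cdiff_const k c : Cdiff Om k (fun _ _ => c).
Proof.
revert c; induction k as [|k IH]; intros c.
- split; [|easy]; intros; split; apply continuity_2d_pt_const.
- apply (Cdiff_intro k _ (fun _ _ _ => RtoC 0)); auto.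
  + intros; split; apply continuity_2d_pt_const.
  + intros; apply is_dd_const.
Qed.

Lemma Cdiff_plus k f g : Cdiff Om k f -> Cdiff Om k g ->
  Cdiff Om k (fun x y => (f x y + g x y)%C).
Proof.
revert f g; induction k as [|k IH]; intros f g Hf Hg.
- split; [|easy]; intros; apply Ccont_plus; eapply Cdiff_cont; eauto.
- apply (Cdiff_intro k _ (fun b x y => (dd b f x y + dd b g x y)%C)).
  + intros; apply Ccont_plus; eapply Cdiff_cont; eauto.
  + intros; apply is_dd_plus; eapply Cdiff_is_dd; eauto.
  + intros b; apply IH; now apply Cdiff_dd.
Qed.

Lemma Cdiff_mult k f g : Cdiff Om k f -> Cdiff Om k g ->
  Cdiff Om k (fun x y => (f x y * g x y)%C).
Proof.
revert f g; induction k as [|k IH]; intros f g Hf Hg.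
- split; [|easy]; intros; apply Ccont_mult; eapply Cdiff_cont; eauto.
- apply (Cdiff_intro k _
    (fun b x y => (dd b f x y * g x y + f x y * dd b g x y)%C)).
  + intros; apply Ccont_mult; eapply Cdiff_cont; eauto.
  + intros; apply is_dd_mult; eapply Cdiff_is_dd; eauto.
  + intros b; apply Cdiff_plus; apply IH;
      (now apply Cdiff_dd) || (now apply Cdiff_S).
Qed.

Lemma Cdiff_Cexp k f : Cdiff Om k f -> Cdiff Om k (fun x y => Cexp (f x y)).
Proof.
induction k as [|k IH]; intros Hf.
- split; [|easy]; intros; apply Ccont_Cexp; eapply Cdiff_cont; eauto.
- apply (Cdiff_intro k _ (fun b x y => (dd b f x y * Cexp (f x y))%C)).
  + intros; apply Ccont_Cexp; eapply Cdiff_cont; eauto.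
  + intros; apply is_dd_Cexp; eapply Cdiff_is_dd; eauto.
  + intros b; apply Cdiff_mult; [now apply Cdiff_dd|]; now apply IH, Cdiff_S.
Qed.

Lemma Cdiff_sum k (F : nat -> R -> R -> C) n :
  (forall l, (l <= n)%nat -> Cdiff Om k (F l)) ->
  Cdiff Om k (fun x y => sum_n (fun l => F l x y) n).
Proof.
induction n as [|n IH]; intros H.
- apply (Cdiff_ext k (F 0%nat)); [|now apply H].
  intros x y _; now rewrite sum_O.
- apply (Cdiff_ext k (fun x y => (sum_n (fun l => F l x y) n + F (S n) x y)%C)).
  + intros x y _; now rewrite sum_Sn.
  + apply Cdiff_plus; [apply IH; intros; apply H; lia | apply H; lia].
Qed.

Lemma dd_plus b f g x y : Cdiff Om 1 f -> Cdiff Om 1 g -> Om (x, y) ->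
  dd b (fun s t => (f s t + g s t)%C) x y = (dd b f x y + dd b g x y)%C.
Proof.
intros Hf Hg H; apply is_dd_unique, is_dd_plus; eapply Cdiff_is_dd; eauto.
Qed.

Lemma dd_mult b f g x y : Cdiff Om 1 f -> Cdiff Om 1 g -> Om (x, y) ->
  dd b (fun s t => (f s t * g s t)%C) x y
  = (dd b f x y * g x y + f x y * dd b g x y)%C.
Proof.
intros Hf Hg H; apply is_dd_unique, is_dd_mult; eapply Cdiff_is_dd; eauto.
Qed.

Lemma dd_scal b c f x y : Cdiff Om 1 f -> Om (x, y) ->
  dd b (fun s t => (c * f s t)%C) x y = (c * dd b f x y)%C.
Proof.
intros Hf H; rewrite dd_mult; auto; [|apply Cdiff_const].
rewrite (is_dd_unique b (fun _ _ => c) x y _ (is_dd_const b c x y)); ring.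
Qed.

Lemma dd_comm f : Cdiff Om 2 f ->
  eq_on (dd true (dd false f)) (dd false (dd true f)).
Proof.
intros Hf x y Hxy.
assert (L := open_2d x y Hxy).
assert (Ht : Cdiff Om 1 (dd true f)) by now apply Cdiff_dd.
assert (Hs : Cdiff Om 1 (dd false f)) by now apply Cdiff_dd.
assert (Cts := Cdiff_cont Om 0 _ x y (Cdiff_dd Om 0 true _ Hs) Hxy).
assert (Cst := Cdiff_cont Om 0 _ x y (Cdiff_dd Om 0 false _ Ht) Hxy).
apply C_eq; unfold dd, CDerive; simpl; apply Schwarz.
- apply locally_2d_impl with (2 := L), locally_2d_forall; intros u v Huv.
  assert (Hs' := Cdiff_is_dd Om 0 true _ u v Hs Huv).
  assert (Ht' := Cdiff_is_dd Om 0 false _ u v Ht Huv).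
  assert (H1 := Cdiff_is_dd Om 1 true f u v Hf Huv).
  assert (H2 := Cdiff_is_dd Om 1 false f u v Hf Huv).
  exact (conj (ex_intro _ _ (proj1 H1)) (conj (ex_intro _ _ (proj1 H2))
          (conj (ex_intro _ _ (proj1 Hs')) (ex_intro _ _ (proj1 Ht'))))).
- exact (proj1 Cts).
- exact (proj1 Cst).
- apply locally_2d_impl with (2 := L), locally_2d_forall; intros u v Huv.
  assert (Hs' := Cdiff_is_dd Om 0 true _ u v Hs Huv).
  assert (Ht' := Cdiff_is_dd Om 0 false _ u v Ht Huv).
  assert (H1 := Cdiff_is_dd Om 1 true f u v Hf Huv).
  assert (H2 := Cdiff_is_dd Om 1 false f u v Hf Huv).
  exact (conj (ex_intro _ _ (proj2 H1)) (conj (ex_intro _ _ (proj2 H2))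
          (conj (ex_intro _ _ (proj2 Hs')) (ex_intro _ _ (proj2 Ht'))))).
- exact (proj2 Cts).
- exact (proj2 Cst).
Qed.

End Domain.

(** * Iterated derivatives and vanishing to a given order *)

Definition dit (b : bool) (i : nat) (f : R -> R -> C) : R -> R -> C :=
  Nat.iter i (dd b) f.

Definition DD (i j : nat) (f : R -> R -> C) : R -> R -> C :=
  dit true i (dit false j f).

Lemma dit_S b i f : dit b (S i) f = dd b (dit b i f).
Proof. reflexivity. Qed.

Lemma dit_S_r b i f : dit b (S i) f = dit b i (dd b f).
Proof. apply Nat.iter_succ_r. Qed.

(** Both sides are the same nest of the total operator [Derive], taken componentwise with the
    y-derivatives innermost, so the identity is purely formal and holds at every point. *)
Lemma pderiv_DD i j f x y : pderiv i j f x y = DD i j f x y.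
Proof.
assert (Hy : forall k g s t, dit false k g s t =
  (Derive_n (fun z => Re (g s z)) k t, Derive_n (fun z => Im (g s z)) k t)).
{ induction k as [|k IH]; intros g s t.
  - now apply C_eq.
  - apply C_eq; simpl; apply Derive_ext; intros z; unfold slice;
      fold (dit false k g); now rewrite IH. }
assert (Hx : forall k g s t, dit true k g s t =
  (Derive_n (fun z => Re (g z t)) k s, Derive_n (fun z => Im (g z t)) k s)).
{ induction k as [|k IH]; intros g s t.
  - now apply C_eq.
  - apply C_eq; simpl; apply Derive_ext; intros z; unfold slice;
      fold (dit true k g); now rewrite IH. }
unfold DD; rewrite Hx; apply C_eq; simpl; apply Derive_n_ext; intros z;
  now rewrite Hy.
Qed.

Section Iterated.

Variables (Om : R * R -> Prop) (Om_open : open Om).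

Lemma dit_ext b i f g : eq_on Om f g -> eq_on Om (dit b i f) (dit b i g).
Proof.
intros E; induction i as [|i IH]; [easy|]; rewrite !dit_S; now apply dd_ext.
Qed.

Lemma Cdiff_dit k b i f : Cdiff Om (i + k) f -> Cdiff Om k (dit b i f).
Proof.
revert f; induction i as [|i IH]; intros f H; [easy|].
rewrite dit_S_r; apply IH, Cdiff_dd, H.
Qed.

Lemma Cdiff_DD k i j f : Cdiff Om (i + j + k) f -> Cdiff Om k (DD i j f).
Proof.
intros H; unfold DD; apply Cdiff_dit, Cdiff_dit.
now replace (j + (i + k))%nat with (i + j + k)%nat by lia.
Qed.

Lemma dit_dd_comm j f : Cdiff Om (S j) f ->
  eq_on Om (dit false j (dd true f)) (dd true (dit false j f)).
Proof.
induction j as [|j IH]; intros Hf; [easy|]; intros x y H; rewrite !dit_S.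
rewrite (dd_ext Om Om_open false _ _ (IH (Cdiff_S _ _ _ Hf)) x y H).
symmetry; apply (dd_comm Om Om_open); auto; apply Cdiff_dit.
now replace (j + 2)%nat with (S (S j)) by lia.
Qed.

(** [DD] takes y-derivatives first. An inner [dd false] is absorbed by [dit_S_r], but an inner
    [dd true] has to be moved past the y-derivatives by Schwarz's theorem. *)
Lemma DD_dd i j f : Cdiff Om (S j) f ->
  eq_on Om (DD i j (dd true f)) (DD (S i) j f).
Proof.
intros Hf; unfold DD; rewrite dit_S_r; apply dit_ext; now apply dit_dd_comm.
Qed.

Lemma dit_plus b i f g : Cdiff Om i f -> Cdiff Om i g ->
  eq_on Om (dit b i (fun x y => (f x y + g x y)%C))
           (fun x y => (dit b i f x y + dit b i g x y)%C).
Proof.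
induction i as [|i IH]; intros Hf Hg; [easy|]; intros x y H; rewrite !dit_S.
rewrite (dd_ext Om Om_open b _ _ (IH (Cdiff_S _ _ _ Hf) (Cdiff_S _ _ _ Hg)) x y H).
apply (dd_plus Om); auto; apply Cdiff_dit; now rewrite Nat.add_1_r.
Qed.

Lemma dit_scal b i c f : Cdiff Om i f ->
  eq_on Om (dit b i (fun x y => (c * f x y)%C))
           (fun x y => (c * dit b i f x y)%C).
Proof.
induction i as [|i IH]; intros Hf; [easy|]; intros x y H; rewrite !dit_S.
rewrite (dd_ext Om Om_open b _ _ (IH (Cdiff_S _ _ _ Hf)) x y H).
apply (dd_scal Om Om_open); auto; apply Cdiff_dit; now rewrite Nat.add_1_r.
Qed.

Lemma dit_sum b i (F : nat -> R -> R -> C) n :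
  (forall l, (l <= n)%nat -> Cdiff Om i (F l)) ->
  eq_on Om (dit b i (fun x y => sum_n (fun l => F l x y) n))
           (fun x y => sum_n (fun l => dit b i (F l) x y) n).
Proof.
induction n as [|n IH]; intros HF x y H.
- rewrite sum_O; apply dit_ext; auto; intros s t _; now rewrite sum_O.
- rewrite sum_Sn, <- IH; auto.
  rewrite (dit_ext b i _
    (fun x y => (sum_n (fun l => F l x y) n + F (S n) x y)%C)); auto.
  + apply dit_plus; auto; apply Cdiff_sum; auto.
  + intros s t _; now rewrite sum_Sn.
Qed.

Lemma DD_ext i j f g : eq_on Om f g -> eq_on Om (DD i j f) (DD i j g).
Proof. intros E; now apply dit_ext, dit_ext. Qed.

Lemma DD_plus i j f g : Cdiff Om (i + j) f -> Cdiff Om (i + j) g ->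
  eq_on Om (DD i j (fun x y => (f x y + g x y)%C))
           (fun x y => (DD i j f x y + DD i j g x y)%C).
Proof.
intros Hf Hg x y H; unfold DD; rewrite <- dit_plus; auto;
  try (apply Cdiff_dit; now rewrite Nat.add_comm).
apply dit_ext; auto; apply dit_plus; now apply (Cdiff_le _ _ (i + j)); [lia|].
Qed.

Lemma DD_scal i j c f : Cdiff Om (i + j) f ->
  eq_on Om (DD i j (fun x y => (c * f x y)%C)) (fun x y => (c * DD i j f x y)%C).
Proof.
intros Hf x y H; unfold DD; rewrite <- dit_scal; auto;
  try (apply Cdiff_dit; now rewrite Nat.add_comm).
apply dit_ext; auto; apply dit_scal; now apply (Cdiff_le _ _ (i + j)); [lia|].
Qed.

Lemma DD_sum i j (F : nat -> R -> R -> C) n :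
  (forall l, (l <= n)%nat -> Cdiff Om (i + j) (F l)) ->
  eq_on Om (DD i j (fun x y => sum_n (fun l => F l x y) n))
           (fun x y => sum_n (fun l => DD i j (F l) x y) n).
Proof.
intros HF x y H; unfold DD.
rewrite <- (dit_sum true i (fun l => dit false j (F l)) n); auto;
  try (intros; apply Cdiff_dit; rewrite Nat.add_comm; auto).
apply dit_ext; auto; apply dit_sum; intros l Hl;
  apply (Cdiff_le _ _ (i + j)); [lia|auto].
Qed.

(** All derivatives of order at most [m], mixed in any order, vanish at [G]. Recursion on first
    derivatives turns the product rule into an induction; [flat_DD] and [flat_intro] translate to
    and from [DD]. *)
Fixpoint flat (G : R * R) (m : nat) (f : R -> R -> C) : Prop :=
  f (fst G) (snd G) = RtoC 0 /\
  match m with O => True | S m' => forall b, flat G m' (dd b f) end.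

Section Flat.

Variables (G : R * R) (G_in : Om G).

Lemma G_in' : Om (fst G, snd G).
Proof. now destruct G. Qed.

Lemma flat_0 m f : flat G m f -> f (fst G) (snd G) = RtoC 0.
Proof. now destruct m; intros [H _]. Qed.

Lemma flat_S m f : flat G (S m) f -> flat G m f.
Proof.
revert f; induction m as [|m IH]; intros f [H1 H2]; split; auto.
Qed.

Lemma flat_le k m f : (k <= m)%nat -> flat G m f -> flat G k f.
Proof. intros H; induction H; [easy|]; intros; now apply IHle, flat_S. Qed.

Lemma flat_ext m f g : eq_on Om f g -> flat G m f -> flat G m g.
Proof.
revert f g; induction m as [|m IH]; intros f g E [H1 H2];
  (split; [rewrite <- E; auto; apply G_in' |]); auto.
intros b; apply (IH (dd b f)); auto; now apply dd_ext.
Qed.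

Lemma flat_dit b i m f : flat G (i + m) f -> flat G m (dit b i f).
Proof.
revert f; induction i as [|i IH]; intros f H; [easy|]; rewrite dit_S_r.
apply IH; destruct H as [_ H]; apply H.
Qed.

Lemma flat_DD m f i j : flat G m f -> (i + j <= m)%nat ->
  DD i j f (fst G) (snd G) = RtoC 0.
Proof.
intros H Hij; apply (flat_0 0), flat_dit, flat_dit.
apply flat_le with (2 := H); lia.
Qed.

Lemma flat_intro m f : Cdiff Om m f ->
  (forall i j, (i + j <= m)%nat -> DD i j f (fst G) (snd G) = RtoC 0) ->
  flat G m f.
Proof.
revert f; induction m as [|m IH]; intros f Hf H;
  (split; [apply (H 0%nat 0%nat); lia|]); auto.
intros b; apply IH; [now apply Cdiff_dd|]; intros i j Hij; destruct b.
- rewrite DD_dd; [apply H; lia| |apply G_in'].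
  apply Cdiff_le with (2 := Hf); lia.
- unfold DD; rewrite <- dit_S_r; apply (H i (S j)); lia.
Qed.

Lemma flat_plus m f g : Cdiff Om m f -> Cdiff Om m g -> flat G m f -> flat G m g ->
  flat G m (fun x y => (f x y + g x y)%C).
Proof.
intros Cf Cg Hf Hg; apply flat_intro; [now apply Cdiff_plus|].
intros i j Hij; rewrite DD_plus; [|now apply (Cdiff_le _ _ m)..|apply G_in'].
rewrite !(flat_DD m); auto; ring.
Qed.

(** Flat functions form an ideal: in f' g + f g', both f' and f are flat to the order lowered by
    one. *)
Lemma flat_mult m f g : Cdiff Om m f -> Cdiff Om m g -> flat G m f ->
  flat G m (fun x y => (f x y * g x y)%C).
Proof.
revert f g; induction m as [|m IH]; intros f g Cf Cg [H1 H2];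
  (split; [rewrite H1; ring|]); auto.
intros b.
apply (flat_ext _ (fun x y => (dd b f x y * g x y + f x y * dd b g x y)%C)).
{ intros x y H; rewrite (dd_mult Om); auto;
    now apply (Cdiff_le _ _ (S m)); [lia|]. }
assert (Cf' := Cdiff_S _ _ _ Cf); assert (Cg' := Cdiff_S _ _ _ Cg).
assert (Df := Cdiff_dd _ _ b _ Cf); assert (Dg := Cdiff_dd _ _ b _ Cg).
apply flat_plus; try (now apply Cdiff_mult); apply IH; auto.
now apply flat_S.
Qed.

End Flat.
End Iterated.

(** * Taylor's inequality *)

(** The factor sqrt 2 is rounded up to 2. *)
Lemma Cmod_le_2Rmax z B : Rabs (Re z) <= B -> Rabs (Im z) <= B -> Cmod z <= 2 * B.
Proof.
intros H1 H2; apply Rle_trans with (1 := Cmod_2Rmax z).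
assert (H : Rmax (Rabs (fst z)) (Rabs (snd z)) <= B) by now apply Rmax_lub.
assert (0 <= B) by (apply Rle_trans with (2 := H1), Rabs_pos).
apply Rmult_le_compat; auto.
- apply sqrt_pos.
- apply Rle_trans with (2 := Rmax_l _ _), Rabs_pos.
- rewrite <- (sqrt_Rsqr 2) at 2 by lra; apply sqrt_le_1_alt; unfold Rsqr; lra.
Qed.

Lemma Re_le_Cmod z : Rabs (Re z) <= Cmod z.
Proof. apply Rle_trans with (2 := Rmax_Cmod z), Rmax_l. Qed.

Lemma Im_le_Cmod z : Rabs (Im z) <= Cmod z.
Proof. apply Rle_trans with (2 := Rmax_Cmod z), Rmax_r. Qed.

(** The mean value theorem has no complex-valued form, so it is applied to the real and imaginary
    parts, which costs the factor 2. *)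
Lemma CDerive_mean_value g g' a b L :
  (forall c, Rabs (c - a) <= Rabs (b - a) ->
     is_CDerive g c (g' c) /\ Cmod (g' c) <= L) ->
  Cmod (g b - g a) <= 2 * (L * Rabs (b - a)).
Proof.
intros H.
assert (P : forall (h h' : R -> R),
  (forall c, Rabs (c - a) <= Rabs (b - a) -> is_derive h c (h' c)) ->
  (forall c, Rabs (c - a) <= Rabs (b - a) -> Rabs (h' c) <= L) ->
  Rabs (h b - h a) <= L * Rabs (b - a)).
{ intros h h' D B; destruct (MVT_cor4 h h' a _ D b (Rle_refl _)) as [c [-> Hc]].
  rewrite Rabs_mult; apply Rmult_le_compat_r; auto using Rabs_pos. }
apply Cmod_le_2Rmax.
- apply (P (fun s => Re (g s)) (fun s => Re (g' s))); intros c Hc.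
  + apply (H c Hc).
  + apply Rle_trans with (1 := Re_le_Cmod _); apply (H c Hc).
- apply (P (fun s => Im (g s)) (fun s => Im (g' s))); intros c Hc.
  + apply (H c Hc).
  + apply Rle_trans with (1 := Im_le_Cmod _); apply (H c Hc).
Qed.

Definition max_dist (G : R * R) (x y : R) : R :=
  Rmax (Rabs (x - fst G)) (Rabs (y - snd G)).

(** The mean value inequality is iterated. By induction the first derivatives are at most [L] on the
    square of radius [rho] centred at [G]; going from [G] to (x, y) through the corner (x, y_G)
    stays in that square and costs 2 L rho on each side. Hence a factor 4 per order. *)
Lemma flat_bound (Om : R * R -> Prop) (Om_open : open Om) G r K m f :
  (forall x y, max_dist G x y < r -> Om (x, y)) ->
  Cdiff Om m f -> (forall k, (k < m)%nat -> flat G k f) ->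
  (forall i j x y, (i + j)%nat = m -> max_dist G x y < r ->
     Cmod (DD i j f x y) <= K) ->
  forall x y, max_dist G x y < r -> Cmod (f x y) <= 4 ^ m * K * max_dist G x y ^ m.
Proof.
intros Hr; revert f; induction m as [|m IH]; intros f Hf Hflat HK x y Hxy.
{ simpl; rewrite Rmult_1_l, Rmult_1_r; now apply (HK 0%nat 0%nat). }
set (rho := max_dist G x y) in *.
assert (Hrho : 0 <= rho) by (apply Rle_trans with (2 := Rmax_l _ _), Rabs_pos).
assert (D : forall b s t, max_dist G s t <= rho ->
  is_dd b f s t (dd b f s t) /\ Cmod (dd b f s t) <= 4 ^ m * K * rho ^ m).
{ intros b s t Hst; assert (Hst' : max_dist G s t < r) by lra; split.
  - now apply (Cdiff_is_dd Om m); auto.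
  - assert (B : Cmod (dd b f s t) <= 4 ^ m * K * max_dist G s t ^ m).
    { apply IH; auto.
      - now apply Cdiff_dd.
      - intros k Hk; now apply (Hflat (S k)); apply -> Nat.succ_lt_mono.
      - intros i j u v Hij Huv; destruct b.
        + rewrite (DD_dd Om); auto; [apply HK; auto; lia|].
          apply Cdiff_le with (2 := Hf); lia.
        + unfold DD; rewrite <- dit_S_r; apply (HK i (S j)); auto; lia. }
    assert (HK0 : 0 <= K).
    { apply Rle_trans with (2 := HK (S m) 0%nat s t (Nat.add_0_r _) Hst').
      apply Cmod_ge_0. }
    apply Rle_trans with (1 := B), Rmult_le_compat_l.
    + apply Rmult_le_pos; auto; apply pow_le; lra.
    + apply pow_incr; split; auto.
      apply Rle_trans with (2 := Rmax_l _ _), Rabs_pos. }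
assert (Hx : Rabs (x - fst G) <= rho) by apply Rmax_l.
assert (Hy : Rabs (y - snd G) <= rho) by apply Rmax_r.
assert (f0 : f (fst G) (snd G) = RtoC 0) by (apply (Hflat 0%nat); lia).
set (L := 4 ^ m * K * rho ^ m) in *.
assert (HL : 0 <= L).
{ apply Rle_trans with (1 := Cmod_ge_0 _) (2 := proj2 (D true x y (Rle_refl _))). }
assert (H1 : Cmod (f x y - f x (snd G)) <= 2 * (L * Rabs (y - snd G))).
{ apply (CDerive_mean_value (fun t => f x t) (fun t => dd false f x t)).
  intros c Hc; apply (D false); apply Rmax_lub; lra. }
assert (H2 : Cmod (f x (snd G) - f (fst G) (snd G)) <= 2 * (L * Rabs (x - fst G))).
{ apply (CDerive_mean_value (fun s => f s (snd G)) (fun s => dd true f s (snd G))).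
  intros c Hc; apply (D true); apply Rmax_lub; try lra.
  rewrite Rminus_diag, Rabs_R0; lra. }
replace (f x y) with
  ((f x y - f x (snd G)) + (f x (snd G) - f (fst G) (snd G)))%C
  by (rewrite f0; ring).
apply Rle_trans with (1 := Cmod_triangle _ _).
replace (4 ^ S m * K * rho ^ S m) with (2 * (L * rho) + 2 * (L * rho))
  by (unfold L; simpl; ring).
assert (L * Rabs (y - snd G) <= L * rho) by now apply Rmult_le_compat_l.
assert (L * Rabs (x - fst G) <= L * rho) by now apply Rmult_le_compat_l.
lra.
Qed.

(** By uniform continuity on the square, the segment from (a, b) to (x, y) can be cut into [N] steps
    along each of which [f] varies by less than 1, with [N] independent of (x, y). *)
Lemma continuity_2d_bounded (f : R -> R -> R) (a b r : R) :
  (forall x y, continuity_2d_pt f x y) ->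
  exists B, forall x y, Rabs (x - a) <= r -> Rabs (y - b) <= r -> Rabs (f x y) <= B.
Proof.
intros Hf.
destruct (uniform_continuity_2d f (a - r) (a + r) (b - r) (b + r)
  (fun x y _ _ => Hf x y) (mkposreal 1 Rlt_0_1)) as [d Hd]; simpl in Hd.
destruct (INR_unbounded (r / d)) as [n Hn].
assert (Hd0 := cond_pos d).
assert (Hn' : r < INR (S n) * d).
{ apply (Rmult_lt_compat_r d) in Hn; auto.
  replace (r / d * d) with r in Hn by (field; lra).
  rewrite S_INR; lra. }
exists (Rabs (f a b) + INR (S n)); intros x y Hx Hy.
set (N := S n) in *.
assert (HN : 0 < INR N) by (apply lt_0_INR; unfold N; lia).
assert (Hstep : forall z, Rabs z <= r -> Rabs (z / INR N) < d).
{ intros z Hz; unfold Rdiv; rewrite Rabs_mult, (Rabs_pos_eq (/ INR N))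
    by now apply Rlt_le, Rinv_0_lt_compat.
  apply (Rmult_lt_reg_r (INR N)); auto.
  rewrite Rmult_assoc, Rinv_l by lra; lra. }
assert (W : forall k z, (k <= N)%nat -> Rabs z <= r -> Rabs (INR k * (z / INR N)) <= r).
{ intros k z Hk Hz.
  replace (INR k * (z / INR N)) with (INR k / INR N * z) by (field; lra).
  rewrite Rabs_mult, <- (Rmult_1_l r); apply Rmult_le_compat; auto using Rabs_pos.
  rewrite Rabs_pos_eq by (apply Rdiv_le_0_compat; auto using pos_INR).
  apply (Rmult_le_reg_r (INR N)); auto; unfold Rdiv.
  rewrite Rmult_assoc, Rinv_l, Rmult_1_r, Rmult_1_l by lra; now apply le_INR. }
assert (P : forall k, (k <= N)%nat ->
  Rabs (f (a + INR k * ((x - a) / INR N)) (b + INR k * ((y - b) / INR N)))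
  <= Rabs (f a b) + INR k).
{ induction k as [|k IH]; intros Hk.
  - simpl; rewrite !Rmult_0_l, !Rplus_0_r; lra.
  - assert (Hk' : (k <= N)%nat) by lia.
    assert (W1 := W _ _ Hk Hx); assert (W2 := W _ _ Hk Hy).
    assert (W3 := W _ _ Hk' Hx); assert (W4 := W _ _ Hk' Hy).
    apply Rabs_le_between in W1; apply Rabs_le_between in W2.
    apply Rabs_le_between in W3; apply Rabs_le_between in W4.
    assert (Q := Hd (a + INR k * ((x - a) / INR N)) (b + INR k * ((y - b) / INR N))
      (a + INR (S k) * ((x - a) / INR N)) (b + INR (S k) * ((y - b) / INR N))).
    refine (_ (Q _ _ _ _ _ _)); try lra; clear Q.
    + intros Q; apply Rabs_def2 in Q.
      assert (IH' := IH Hk'); apply Rabs_le_between in IH'.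
      rewrite !S_INR in *; apply Rabs_le_between; lra.
    + rewrite S_INR; replace (_ - _) with ((x - a) / INR N) by ring; now apply Hstep.
    + rewrite S_INR; replace (_ - _) with ((y - b) / INR N) by ring; now apply Hstep. }
specialize (P N (Nat.le_refl _)).
replace (a + INR N * ((x - a) / INR N)) with x in P by (field; lra).
now replace (b + INR N * ((y - b) / INR N)) with y in P by (field; lra).
Qed.

Lemma Ccont_bounded (f : R -> R -> C) (a b r : R) :
  (forall x y, Ccont f x y) ->
  exists B, forall x y, Rabs (x - a) <= r -> Rabs (y - b) <= r -> Cmod (f x y) <= B.
Proof.
intros Hf.
destruct (continuity_2d_bounded (fun x y => Re (f x y)) a b r) as [B1 H1];
  [apply Hf|].
destruct (continuity_2d_bounded (fun x y => Im (f x y)) a b r) as [B2 H2];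
  [apply Hf|].
exists (2 * Rmax B1 B2); intros x y Hx Hy; apply Cmod_le_2Rmax.
- apply Rle_trans with (2 := Rmax_l _ _); auto.
- apply Rle_trans with (2 := Rmax_r _ _); auto.
Qed.

Lemma finite_bound (P : nat -> R -> Prop) n :
  (forall k B B', B <= B' -> P k B -> P k B') ->
  (forall k, (k <= n)%nat -> exists B, P k B) ->
  exists B, forall k, (k <= n)%nat -> P k B.
Proof.
intros Hmono; induction n as [|n IH]; intros H.
- destruct (H 0%nat (Nat.le_refl _)) as [B HB]; exists B; intros k Hk.
  now replace k with 0%nat by lia.
- destruct IH as [B1 H1]; [now auto|]; destruct (H (S n) (Nat.le_refl _)) as [B2 H2].
  exists (Rmax B1 B2); intros k Hk; destruct (Nat.eq_dec k (S n)) as [->|].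
  + now apply (Hmono _ B2); [apply Rmax_r|].
  + apply (Hmono _ B1); [apply Rmax_l|]; apply H1; lia.
Qed.

(** * Trigonometric interpolation *)

(** Two distinct angles with the same sine would add up to an odd multiple of
    [PI], which is impossible for multiples of [2 * PI / (2 * n + 1)]. *)
Lemma sin_gpw_angle_inj n k l : (k <= 2 * n)%nat -> (l <= 2 * n)%nat ->
  sin (gpw_angle (2 * n + 1) (S k)) = sin (gpw_angle (2 * n + 1) (S l)) -> k = l.
Proof.
intros Hk Hl H; unfold gpw_angle in H.
replace (S k - 1)%nat with k in H by lia; replace (S l - 1)%nat with l in H by lia.
set (p := (2 * n + 1)%nat) in *.
assert (Hp : 0 < INR p) by (apply lt_0_INR; lia).
assert (HPI := PI_RGT_0).
(* [form4] is sin a - sin b = 2 cos((a - b)/2) sin((a + b)/2) up to the roles of the two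
   half-angles: here the cosine carries the half-sum and the sine the half-difference. *)
apply Rminus_diag_eq in H; rewrite form4 in H.
apply Rmult_integral in H; destruct H as [H|H].
- apply Rmult_integral in H; destruct H as [H|H]; [lra|].
  destruct (cos_eq_0_0 _ H) as [m Hm].
  assert (E : 2 * (INR k + INR l) = (2 * IZR m + 1) * INR p).
  { apply (Rmult_eq_reg_r (PI / (2 * INR p))).
    - transitivity ((2 * PI * INR k / INR p + 2 * PI * INR l / INR p) / 2);
        [field; lra|]; rewrite Hm; field; lra.
    - apply Rgt_not_eq, Rdiv_lt_0_compat; lra. }
  exfalso; rewrite !INR_IZR_INZ in E.
  rewrite <- plus_IZR, <- !mult_IZR, <- plus_IZR, <- mult_IZR in E.
  (* An even number would be a product of two odd ones. *)
  apply eq_IZR in E; lia.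
- destruct (sin_eq_0_0 _ H) as [m Hm].
  assert (E : INR k - INR l = IZR m * INR p).
  { apply (Rmult_eq_reg_r (PI / INR p)).
    - transitivity ((2 * PI * INR k / INR p - 2 * PI * INR l / INR p) / 2);
        [field; lra|]; rewrite Hm; field; lra.
    - apply Rgt_not_eq, Rdiv_lt_0_compat; lra. }
  (* Since |k - l| < p, the only possible multiple of [p] is 0. *)
  rewrite !INR_IZR_INZ, <- minus_IZR, <- mult_IZR in E; apply eq_IZR in E.
  assert (m = 0%Z) by nia; lia.
Qed.

(** Basis of the trigonometric polynomials of degree at most [n]. *)
Definition trig_basis (n j : nat) (theta : R) : R :=
  if Nat.leb j n then sin theta ^ j else cos theta * sin theta ^ (j - S n).

Module TrigonometricInterpolation.
Import all_boot all_algebra Rstruct zify.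
Import GRing.Theory Num.Theory.
Local Open Scope ring_scope.

(** The polynomial 1 - X^2 has a simple root at 1 because 2 is nonzero, so the left side vanishes
    there to even order and the right side to odd order. The proof is the corresponding descent: [A]
    and [B] are both divisible by X - 1, and the quotients satisfy the same equation. *)
Lemma one_minus_sqr_not_square (F : fieldType) (A B : {poly F}) :
  (2%:R : F) != 0 -> A ^+ 2 = (1 - 'X ^+ 2) * B ^+ 2 -> A = 0 /\ B = 0.
Proof.
move=> two0; have [m] := ubnP (size A); elim: m A B => // m IH A B szA E.
have A1 : root A 1.
  have : A.[1] ^+ 2 == 0.
    by rewrite -horner_exp E hornerM hornerD hornerN hornerXn hornerC expr1n subrr mul0r.
  by rewrite expf_eq0.
have [A' EA] := factor_theorem _ _ A1.
have X1 : ('X - 1%:P : {poly F}) != 0 by rewrite polyXsubC_eq0.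
have sqr1 : - ('X + 1%:P) * ('X - 1%:P) = 1 - 'X ^+ 2 :> {poly F}.
  have S : 'X ^+ 2 - 1%:P ^+ 2 = ('X + 1%:P) * ('X - 1%:P) :> {poly F}.
    by rewrite subr_sqr mulrC.
  by rewrite mulNr -S polyC1 expr1n opprB.
have E1 : A' ^+ 2 * ('X - 1%:P) = - ('X + 1%:P) * B ^+ 2.
  apply: (mulIf X1); rewrite -mulrA -expr2 -exprMn -EA E.
  by rewrite mulrAC; congr (_ * _); rewrite sqr1.
have B1 : root B 1.
  have := congr1 (horner^~ 1) E1.
  rewrite !hornerM hornerN !hornerD hornerN !hornerX !hornerC subrr mulr0.
  move/eqP; rewrite eq_sym !mulf_eq0 oppr_eq0 orbb.
  by rewrite -[1 + 1]/(2%:R) (negbTE two0).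
have [B' EB] := factor_theorem _ _ B1.
have E2 : A' ^+ 2 = (1 - 'X ^+ 2) * B' ^+ 2.
  apply: (mulIf X1); rewrite E1 EB exprMn [(_ - _) ^+ 2]expr2 !mulrA; congr (_ * _).
  rewrite mulrAC; congr (_ * _); rewrite mulrAC; congr (_ * _).
  exact: sqr1.
(* Dividing by X - 1 lowers the size only when the quotient is nonzero, so a zero quotient is
   treated apart. *)
have [A0|A0] := eqVneq A' 0.
  have B0 : B' = 0.
    apply/eqP; move/eqP: E2; rewrite A0 expr0n /= eq_sym mulf_eq0 expf_eq0 /=.
    case/orP=> //; rewrite subr_eq0 => /eqP/(congr1 (fun p : {poly F} => size p)).
    by rewrite size_poly1 size_polyXn.
  by rewrite EA EB A0 B0 !mul0r.
have [] := IH A' B' _ E2; last by move=> A'0; rewrite A'0 eqxx in A0.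
move: szA; rewrite EA size_Mmonic ?monicXsubC // size_XsubC addn2 /=.
by rewrite ltnS.
Qed.

Lemma sum_n_bigop (F : nat -> R) n : sum_n F n = \sum_(i < n.+1) F i.
Proof.
elim: n => [|n IH]; first by rewrite sum_O big_ord_recl big_ord0 addr0.
by rewrite sum_Sn IH [RHS]big_ord_recr.
Qed.

(** The sum runs over the angles: [E] is a right inverse of the matrix of basis values, so its
    columns are weights that realize prescribed moments. The matrix being square, it is enough that
    its rows are free, that is, that only the zero trigonometric polynomial vanishes at all the
    angles. *)
Lemma trig_interpolation (n : nat) : (1 <= n)%coq_nat -> exists E : nat -> nat -> R,
  forall j k, (j <= 2 * n)%coq_nat -> (k <= 2 * n)%coq_nat ->
  sum_n (fun l => trig_basis n j (gpw_angle (2 * n + 1) (S l)) * E l k) (2 * n)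
  = if Nat.eqb j k then 1 else 0.
Proof.
move=> n_ge1; pose th (l : nat) := gpw_angle (2 * n + 1) (S l).
pose M : 'M[R]_((2 * n).+1) := \matrix_(j, l) trig_basis n j (th l).
have freeM : row_free M.
  apply: inj_row_free => v /rowP vM.
  pose c (j : nat) : R := v 0 (inord j).
  (* The coefficients of a vanishing combination of rows, split according to the two halves of
     [trig_basis]. *)
  pose A := \poly_(i < n.+1) c i; pose B := \poly_(i < n) c (n.+1 + i)%N.
  have AB (l : 'I_(2 * n).+1) : A.[sin (th l)] + cos (th l) * B.[sin (th l)] = 0.
    have := vM l; rewrite !mxE => <-.
    rewrite !horner_poly mulr_sumr.
    rewrite -(big_mkord xpredT (fun j => c j * sin (th l) ^+ j)).
    rewrite -(big_mkord xpredT
      (fun j => cos (th l) * (c (n.+1 + j)%N * sin (th l) ^+ j))).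
    have -> : \sum_(j < (2 * n).+1) v 0 j * M j l =
      \sum_(0 <= j < (2 * n).+1) c j * trig_basis n j (th l).
      rewrite big_mkord; apply: eq_bigr => j _; by rewrite mxE /c inord_val.
    rewrite [RHS](big_cat_nat (n := n.+1)) /=; [|by lia..].
    congr (_ + _).
      apply: eq_big_nat => j /andP [_ jn]; rewrite /trig_basis.
      have -> : Nat.leb j n = true by apply/Nat.leb_le/leP; rewrite -ltnS.
      by rewrite RpowE.
    rewrite -[in RHS](add0n n.+1) big_addn (_ : ((2 * n).+1 - n.+1 = n)%N); last by lia.
    apply: eq_big_nat => j _; rewrite /trig_basis.
    have -> : Nat.leb (j + n.+1) n = false by apply/Nat.leb_gt/ltP; lia.
    have -> : Nat.sub (j + n.+1) (S n) = j by lia.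
    by rewrite RpowE mulrCA addnC.
  pose Q := A ^+ 2 - (1 - 'X ^+ 2) * B ^+ 2.
  have Q0 : Q = 0.
    apply/eqP/negPn/negP => Qn0.
    (* [size] is the degree plus one: the size of [Q] is at most 2 n + 1, whereas as many roots
       force a larger one. *)
    suff: ((2 * n).+1 < size Q)%N.
      rewrite ltnNge => /negP; apply.
      have szA : (size A <= n.+1)%N by exact: size_poly.
      have szB : (size B <= n)%N by exact: size_poly.
      have szX : (size (1 - 'X ^+ 2 : {poly R})%R <= 3)%N.
        rewrite (leq_trans (size_polyD _ _)) // size_polyN size_polyXn size_poly1.
        by [].
      rewrite /Q (leq_trans (size_polyD _ _)) // size_polyN geq_max.
      have szBB : (size (B ^+ 2)%R <= (n + n).-1)%N.
        by rewrite expr2 (leq_trans (size_polyMleq _ _)) //; lia.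
      apply/andP; split.
        by rewrite expr2 (leq_trans (size_polyMleq _ _)) //; lia.
      apply: (leq_trans (size_polyMleq _ _)); move: szX szBB.
      move: (size _) (size _) => s1 s2; lia.
    have := max_poly_roots Qn0 (rs := [seq sin (th l) | l <- iota 0 (2 * n).+1]).
    rewrite size_map size_iota; apply.
    - apply/allP => x /mapP [l]; rewrite mem_iota add0n => /andP [_ ll] ->.
      have := AB (Ordinal ll); rewrite /= => /eqP; rewrite addr_eq0 => /eqP Al.
      have cs : cos (th l) ^+ 2 = 1 - sin (th l) ^+ 2.
        apply/eqP; rewrite eq_sym subr_eq addrC eq_sym; apply/eqP.
        exact: sin2_cos2.
      by rewrite /root /Q !hornerE Al sqrrN exprMn cs subr_eq0 expr2 /= mulrA.
    - rewrite map_inj_in_uniq ?iota_uniq // => k l.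
      rewrite !mem_iota !add0n => /andP [_ kn] /andP [_ ln].
      by apply: sin_gpw_angle_inj; apply/leP.
  have two0 : (2%:R : R) != 0 by rewrite pnatr_eq0.
  have [A0 B0] := one_minus_sqr_not_square _ _ _ two0 (subr0_eq Q0).
  (* The entries of [v] are the coefficients of [A] up to index [n], and those of [B] beyond. *)
  apply/rowP => j; rewrite mxE -[j]inord_val.
  have [jn|nj] := ltnP j n.+1.
    by have := congr1 (fun p : {poly R} => p`_j) A0; rewrite coef_poly jn coef0.
  have := congr1 (fun p : {poly R} => p`_(j - n.+1)) B0.
  by rewrite coef_poly coef0 subnKC // ltn_subLR // addSn addnn -mul2n ltn_ord.
exists (fun l k => pinvmx M (inord l) (inord k)) => j k /leP jn /leP kn.
rewrite sum_n_bigop.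
have /matrixP/(_ (inord j) (inord k)) := mulmxVp freeM.
rewrite !mxE => E; transitivity ((inord j == inord k :> 'I_(2 * n).+1)%:R : R).
  rewrite -E; apply: eq_bigr => l _.
  by rewrite inord_val [M _ _]mxE inordK.
have -> : (inord j == inord k :> 'I_(2 * n).+1) = Nat.eqb j k.
  rewrite -val_eqE /= !inordK //; by apply/eqP/Nat.eqb_spec.
by case: Nat.eqb.
Qed.
End TrigonometricInterpolation.

(** * Taylor coefficients *)

Lemma NtoC_S_neq0 k : NtoC (S k) <> RtoC 0.
Proof.
unfold NtoC; intros H; apply RtoC_inj in H; revert H; apply not_0_INR; lia.
Qed.

Lemma NtoC_fact_S k : NtoC (fact (S k)) = (NtoC (S k) * NtoC (fact k))%C.
Proof. unfold NtoC; now rewrite fact_simpl, mult_INR, RtoC_mult. Qed.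

Lemma NtoC_fact_neq0 k : NtoC (fact k) <> RtoC 0.
Proof. unfold NtoC; intros H; apply RtoC_inj in H; revert H; apply INR_fact_neq_0. Qed.

Lemma Cmult_cancel_l (c a b : C) : c <> RtoC 0 -> (c * a = c * b)%C -> a = b.
Proof.
intros Hc H; replace a with (/ c * (c * a))%C by (field; auto).
rewrite H; field; auto.
Qed.

(** * Finite sums of complex numbers *)

Lemma Csum_ext (f g : nat -> C) n : (forall k, (k <= n)%nat -> f k = g k) ->
  sum_n f n = sum_n g n.
Proof. apply (sum_n_ext_loc (G := C_AbelianMonoid)). Qed.

Lemma Csum_plus (f g : nat -> C) n :
  sum_n (fun k => (f k + g k)%C) n = (sum_n f n + sum_n g n)%C.
Proof. apply (sum_n_plus (G := C_AbelianMonoid)). Qed.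

Lemma Csum_scal c (f : nat -> C) n :
  sum_n (fun k => (c * f k)%C) n = (c * sum_n f n)%C.
Proof. apply (sum_n_mult_l (K := C_Ring)). Qed.

Lemma Csum_single (f : nat -> C) n a : (a <= n)%nat ->
  (forall k, (k <= n)%nat -> k <> a -> f k = RtoC 0) -> sum_n f n = f a.
Proof.
revert a; induction n as [|n IH]; intros a Ha H.
- rewrite sum_O; now replace a with 0%nat by lia.
- rewrite sum_Sn; destruct (Nat.eq_dec a (S n)) as [->|Hn].
  + rewrite (sum_n_ext_loc _ (fun _ => zero)).
    * unfold sum_n; rewrite sum_n_m_const_zero; apply (plus_zero_l (G := C_AbelianMonoid)).
    * intros k Hk; apply H; lia.
  + rewrite (IH a), (H (S n)); try lia.
    * apply (plus_zero_r (G := C_AbelianMonoid)).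
    * intros k Hk; apply H; lia.
Qed.

Lemma Csum_0 (f : nat -> C) n : (forall k, (k <= n)%nat -> f k = RtoC 0) ->
  sum_n f n = RtoC 0.
Proof. intros H; rewrite (Csum_single _ _ 0); auto with arith. Qed.

Lemma Csum_Sn_l (f : nat -> C) n :
  sum_n f (S n) = (f 0%nat + sum_n (fun k => f (S k)) n)%C.
Proof.
unfold sum_n; rewrite sum_Sn_m by lia; now rewrite <- (sum_n_m_S f).
Qed.

(** The derivation rule for the product of two formal power series. *)
Lemma convolution_S (a b : nat -> C) i :
  sum_n (fun k => (NtoC (S (i - k)) * a (S (i - k)) * b k
                   + a (i - k)%nat * (NtoC (S k) * b (S k)))%C) i
  = (NtoC (S i) * sum_n (fun k => (a (S i - k)%nat * b k)%C) (S i))%C.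
Proof.
(* In the right-hand sum write S i = (S i - k) + k. The two resulting sums are those on the left,
   after dropping the zero end term of each and shifting the index in [B]. *)
set (A := fun k => (NtoC (S i - k) * a (S i - k)%nat * b k)%C).
set (B := fun k => (NtoC k * a (S i - k)%nat * b k)%C).
rewrite Csum_plus, <- Csum_scal.
transitivity (sum_n A (S i) + sum_n B (S i))%C.
- apply (f_equal2 Cplus).
  + rewrite sum_Sn.
    replace (A (S i)) with (RtoC 0)
      by (unfold A; rewrite Nat.sub_diag; unfold NtoC; simpl; ring).
    rewrite (plus_zero_r (G := C_AbelianMonoid)).
    apply Csum_ext; intros k Hk; unfold A.
    now replace (S i - k)%nat with (S (i - k)) by lia.
  + rewrite Csum_Sn_l.
    replace (B 0%nat) with (RtoC 0) by (unfold B, NtoC; simpl; ring).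
    rewrite Cplus_0_l; apply Csum_ext; intros k _; unfold B; simpl (S i - S k)%nat; ring.
- rewrite <- Csum_plus; apply Csum_ext; intros k Hk; unfold A, B.
  replace (NtoC (S i)) with (NtoC (S i - k) + NtoC k)%C; [ring|].
  unfold NtoC; rewrite <- RtoC_plus, <- plus_INR; do 2 f_equal; lia.
Qed.

Section TaylorCoefficients.

Variables (Om : R * R -> Prop) (Om_open : open Om).

Definition Cinf (f : R -> R -> C) : Prop := forall k, Cdiff Om k f.

Lemma Cinf_plus f g : Cinf f -> Cinf g -> Cinf (fun x y => (f x y + g x y)%C).
Proof. intros Hf Hg k; now apply Cdiff_plus. Qed.

Lemma Cinf_mult f g : Cinf f -> Cinf g -> Cinf (fun x y => (f x y * g x y)%C).
Proof. intros Hf Hg k; now apply Cdiff_mult. Qed.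

Lemma Cinf_scal c f : Cinf f -> Cinf (fun x y => (c * f x y)%C).
Proof. intros Hf; apply Cinf_mult; auto; intros k; now apply Cdiff_const. Qed.

Lemma Cinf_dd b f : Cinf f -> Cinf (dd b f).
Proof. intros Hf k; apply Cdiff_dd, Hf. Qed.

Lemma Cinf_sum (F : nat -> R -> R -> C) n : (forall l, (l <= n)%nat -> Cinf (F l)) ->
  Cinf (fun x y => sum_n (fun l => F l x y) n).
Proof. intros HF k; apply Cdiff_sum; auto; intros; now apply HF. Qed.

(** The Taylor coefficient is kept as a function of the point, so that the two directions can be
    composed; dividing by the factorial removes the binomials from the Leibniz rule. *)
Definition tay (b : bool) (i : nat) (f : R -> R -> C) (x y : R) : C :=
  (/ NtoC (fact i) * dit b i f x y)%C.

Lemma Cinf_tay b i f : Cinf f -> Cinf (tay b i f).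
Proof. intros Hf; apply Cinf_scal; intros k; apply Cdiff_dit, Hf. Qed.

Lemma tay_ext b i f g : eq_on Om f g -> eq_on Om (tay b i f) (tay b i g).
Proof. intros E x y H; unfold tay; now rewrite (dit_ext Om Om_open b i f g). Qed.

Lemma tay_S b i f x y : (NtoC (S i) * tay b (S i) f x y)%C = tay b i (dd b f) x y.
Proof.
unfold tay; rewrite dit_S_r, NtoC_fact_S.
field; split; [apply NtoC_fact_neq0|apply NtoC_S_neq0].
Qed.

Lemma tay_plus b i f g : Cinf f -> Cinf g ->
  eq_on Om (tay b i (fun x y => (f x y + g x y)%C))
           (fun x y => (tay b i f x y + tay b i g x y)%C).
Proof.
intros Hf Hg x y H; unfold tay; rewrite (dit_plus Om Om_open b i f g); auto; ring.
Qed.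

Lemma tay_scal b i c f : Cinf f ->
  eq_on Om (tay b i (fun x y => (c * f x y)%C)) (fun x y => (c * tay b i f x y)%C).
Proof.
intros Hf x y H; unfold tay; rewrite (dit_scal Om Om_open b i c f); auto; ring.
Qed.

Lemma tay_sum b i (F : nat -> R -> R -> C) n : (forall l, (l <= n)%nat -> Cinf (F l)) ->
  eq_on Om (tay b i (fun x y => sum_n (fun l => F l x y) n))
           (fun x y => sum_n (fun l => tay b i (F l) x y) n).
Proof.
intros HF x y H; unfold tay; rewrite (dit_sum Om Om_open b i F n); auto.
- now rewrite Csum_scal.
- intros; now apply HF.
Qed.

(** Multiplied by i + 1, the formula at order i + 1 becomes the one at order i for the two terms of
    the derivative of the product; [convolution_S] reassembles them. *)
Lemma tay_mult b i f g : Cinf f -> Cinf g ->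
  eq_on Om (tay b i (fun x y => (f x y * g x y)%C))
    (fun x y => sum_n (fun k => (tay b (i - k) f x y * tay b k g x y)%C) i).
Proof.
revert f g; induction i as [|i IH]; intros f g Hf Hg x y H.
- rewrite sum_O; unfold tay, NtoC; simpl; field; apply R1_neq_R0.
- apply (Cmult_cancel_l (NtoC (S i))); [apply NtoC_S_neq0|].
  rewrite tay_S, <- (convolution_S (fun k => tay b k f x y) (fun k => tay b k g x y)).
  assert (Hf' := Cinf_dd b f Hf); assert (Hg' := Cinf_dd b g Hg).
  rewrite (tay_ext b i _ (fun s t => (dd b f s t * g s t + f s t * dd b g s t)%C)); auto.
  + rewrite tay_plus, !IH; auto using Cinf_mult; rewrite <- Csum_plus.
    apply Csum_ext; intros k _; now rewrite <- !tay_S.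
  + intros s t Hst; apply (dd_mult Om); auto.
Qed.

Variables (G : R * R) (G_in : Om G).

Let Gin : Om (fst G, snd G) := G_in' Om G G_in.

(** Coefficient of (x - x_G)^i (y - y_G)^j in the Taylor expansion of [f] at [G]. *)
Definition T (i j : nat) (f : R -> R -> C) : C :=
  tay true i (tay false j f) (fst G) (snd G).

Lemma T_ext i j f g : eq_on Om f g -> T i j f = T i j g.
Proof. intros E; apply tay_ext; auto; now apply tay_ext. Qed.

Lemma T_plus i j f g : Cinf f -> Cinf g ->
  T i j (fun x y => (f x y + g x y)%C) = (T i j f + T i j g)%C.
Proof.
intros Hf Hg; unfold T; rewrite <- tay_plus; auto using Cinf_tay.
apply tay_ext; auto; now apply tay_plus.
Qed.

Lemma T_scal i j c f : Cinf f -> T i j (fun x y => (c * f x y)%C) = (c * T i j f)%C.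
Proof.
intros Hf; unfold T; rewrite <- tay_scal; auto using Cinf_tay.
apply tay_ext; auto; now apply tay_scal.
Qed.

Lemma T_sum i j (F : nat -> R -> R -> C) n : (forall l, (l <= n)%nat -> Cinf (F l)) ->
  T i j (fun x y => sum_n (fun l => F l x y) n) = sum_n (fun l => T i j (F l)) n.
Proof.
intros HF; unfold T.
rewrite <- (tay_sum true i (fun l => tay false j (F l)) n); auto using Cinf_tay.
apply tay_ext; auto; now apply tay_sum.
Qed.

Lemma T_mult i j f g : Cinf f -> Cinf g ->
  T i j (fun x y => (f x y * g x y)%C)
  = sum_n (fun k => sum_n (fun l => (T (i - k) (j - l) f * T k l g)%C) j) i.
Proof.
intros Hf Hg; unfold T.
rewrite (tay_ext true i _ _ (tay_mult false j f g Hf Hg)); auto.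
rewrite (tay_sum true i
  (fun l x y => (tay false (j - l) f x y * tay false l g x y)%C) j);
  auto using Cinf_mult, Cinf_tay.
rewrite <- (sum_n_switch (G := C_AbelianMonoid)).
apply Csum_ext; intros l _; apply tay_mult; auto using Cinf_tay.
Qed.

Lemma T_DD i j f : Cinf f ->
  DD i j f (fst G) (snd G) = (NtoC (fact i) * NtoC (fact j) * T i j f)%C.
Proof.
intros Hf; unfold T; unfold tay at 2; rewrite tay_scal; auto.
- unfold tay, DD; field; split; apply NtoC_fact_neq0.
- intros k; apply Cdiff_dit, Hf.
Qed.

Lemma T_dx i j f : Cinf f -> T i j (dd true f) = (NtoC (S i) * T (S i) j f)%C.
Proof.
intros Hf; apply (Cmult_cancel_l (NtoC (fact i) * NtoC (fact j))%C).
- apply Cmult_neq_0; apply NtoC_fact_neq0.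
- rewrite <- T_DD by now apply Cinf_dd.
  rewrite (DD_dd Om Om_open i j f (Hf _) _ _ Gin), T_DD, NtoC_fact_S by easy; ring.
Qed.

Lemma T_dy i j f : Cinf f -> T i j (dd false f) = (NtoC (S j) * T i (S j) f)%C.
Proof.
intros Hf; unfold T; rewrite <- tay_scal; auto using Cinf_tay.
apply tay_ext; auto; intros x y H; symmetry; apply tay_S.
Qed.

Lemma T_flat m f : Cinf f -> (forall i j, (i + j <= m)%nat -> T i j f = RtoC 0) ->
  flat G m f.
Proof.
intros Hf H; apply (flat_intro Om Om_open G G_in); auto.
intros i j Hij; rewrite T_DD, H; auto; ring.
Qed.

(** * Taylor coefficients of monomials *)

Definition monomial (a b : nat) (x y : R) : C :=
  RtoC ((x - fst G) ^ a * (y - snd G) ^ b).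

Lemma is_dx_monomial a b x y :
  is_dd true (monomial a b) x y (NtoC a * monomial (pred a) b x y)%C.
Proof.
split; simpl.
- auto_derive; [easy|]; unfold NtoC, Re, Rminus; simpl; ring.
- evar_last; [apply (is_derive_const (V := R_NormedModule))|].
  unfold zero; simpl; ring.
Qed.

Lemma is_dy_monomial a b x y :
  is_dd false (monomial a b) x y (NtoC b * monomial a (pred b) x y)%C.
Proof.
split; simpl.
- auto_derive; [easy|]; unfold NtoC, Re, Rminus; simpl; ring.
- evar_last; [apply (is_derive_const (V := R_NormedModule))|].
  unfold zero; simpl; ring.
Qed.

Lemma continuity_2d_pow (f : R -> R -> R) x y k : continuity_2d_pt f x y ->
  continuity_2d_pt (fun s t => f s t ^ k) x y.
Proof.
intros H; induction k as [|k IH]; simpl; [apply continuity_2d_pt_const|].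
now apply continuity_2d_pt_mult.
Qed.

Lemma Ccont_monomial a b x y : Ccont (monomial a b) x y.
Proof.
split; simpl; [|apply continuity_2d_pt_const].
apply continuity_2d_pt_mult; apply continuity_2d_pow, continuity_2d_pt_minus;
  auto using continuity_2d_pt_id1, continuity_2d_pt_id2, continuity_2d_pt_const.
Qed.

Lemma Cinf_monomial a b : Cinf (monomial a b).
Proof.
intros k; revert a b; induction k as [|k IH]; intros a b.
- split; auto; intros; apply Ccont_monomial.
- apply (Cdiff_intro Om Om_open k _ (fun d : bool =>
    if d then fun x y => (NtoC a * monomial (pred a) b x y)%C
    else fun x y => (NtoC b * monomial a (pred b) x y)%C)).
  + intros; apply Ccont_monomial.
  + intros [|] x y _; [apply is_dx_monomial | apply is_dy_monomial].
  + intros [|]; apply Cdiff_mult; auto; now apply Cdiff_const.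
Qed.

Lemma T_monomial i j a b : T i j (monomial a b) =
  if andb (Nat.eqb i a) (Nat.eqb j b) then RtoC 1 else RtoC 0.
Proof.
revert a; induction i as [|i IH]; intros a.
- revert b; induction j as [|j IH]; intros b.
  + unfold T, tay, NtoC, monomial; simpl.
    rewrite !Rminus_diag.
    destruct a as [|a], b as [|b]; simpl; rewrite ?Rmult_0_l, ?Rmult_1_l;
      field; apply R1_neq_R0.
  + apply (Cmult_cancel_l (NtoC (S j))); [apply NtoC_S_neq0|].
    rewrite <- T_dy by apply Cinf_monomial.
    rewrite (T_ext _ _ _ (fun x y => (NtoC b * monomial a (pred b) x y)%C))
      by (intros x y _; apply is_dd_unique, is_dy_monomial).
    rewrite T_scal, IH by apply Cinf_monomial.
    destruct b as [|b]; simpl.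
    * unfold NtoC; simpl; rewrite Bool.andb_false_r; ring.
    * destruct (Nat.eqb_spec j b) as [->|]; [easy|].
      rewrite Bool.andb_false_r; ring.
- apply (Cmult_cancel_l (NtoC (S i))); [apply NtoC_S_neq0|].
  rewrite <- T_dx by apply Cinf_monomial.
  rewrite (T_ext _ _ _ (fun x y => (NtoC a * monomial (pred a) b x y)%C))
    by (intros x y _; apply is_dd_unique, is_dx_monomial).
  rewrite T_scal, IH by apply Cinf_monomial.
  destruct a as [|a]; simpl.
  + unfold NtoC; simpl; ring.
  + destruct (Nat.eqb_spec i a) as [->|]; [easy|]; simpl; ring.
Qed.

End TaylorCoefficients.

(** * Taylor coefficients of a generalized plane wave *)

Section GeneralizedPlaneWave.

Variables (Om : R * R -> Prop) (Om_open : open Om).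
Variables (beta : R -> R -> C) (G : R * R) (G_in : Om G).
Variables (N : C) (theta : R) (q : nat).

Let lam := gpw_coeff beta G N theta.
Let P := gpw_phase beta G N theta q.
Let phi := gpw beta G N theta q.

Lemma Cinf_phase_row i n : Cinf Om (fun x y =>
  sum_n (fun j => (lam i j * monomial G i j x y)%C) n).
Proof.
apply (Cinf_sum Om Om_open (fun j x y => (lam i j * monomial G i j x y)%C)).
intros; apply Cinf_scal, Cinf_monomial; auto.
Qed.

Lemma Cinf_phase : Cinf Om P.
Proof.
apply (Cinf_sum Om Om_open (fun i x y =>
  sum_n (fun j => (lam i j * monomial G i j x y)%C) (q + 1 - i))).
intros; apply Cinf_phase_row.
Qed.

Lemma Cinf_gpw : Cinf Om phi.
Proof. intros k; apply (Cdiff_Cexp Om Om_open), Cinf_phase. Qed.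

Lemma T_phase a b : (a + b <= q + 1)%nat -> T G a b P = lam a b.
Proof.
intros Hab; unfold P, gpw_phase.
rewrite (T_sum Om Om_open G G_in a b (fun i x y =>
  sum_n (fun j => (lam i j * monomial G i j x y)%C) (q + 1 - i)))
  by (intros; apply Cinf_phase_row).
assert (Row : forall i, T G a b (fun x y =>
    sum_n (fun j => (lam i j * monomial G i j x y)%C) (q + 1 - i)) =
  sum_n (fun j => (lam i j * (if andb (Nat.eqb a i) (Nat.eqb b j) then RtoC 1
                              else RtoC 0))%C) (q + 1 - i)).
{ intros i.
  rewrite (T_sum Om Om_open G G_in a b (fun j x y => (lam i j * monomial G i j x y)%C))
    by (intros; apply Cinf_scal, Cinf_monomial; auto).
  apply Csum_ext; intros j _.
  rewrite (T_scal Om), (T_monomial Om); auto using Cinf_monomial. }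
rewrite (Csum_single _ _ a); [|lia|].
- rewrite Row, (Csum_single _ _ b); [|lia|].
  + rewrite !Nat.eqb_refl; simpl; ring.
  + intros j _ Hj; apply Nat.eqb_neq in Hj; rewrite (Nat.eqb_sym b j), Hj.
    rewrite Bool.andb_false_r; ring.
- intros i _ Hi; rewrite Row; apply Csum_0; intros j _.
  apply Nat.eqb_neq in Hi; rewrite (Nat.eqb_sym a i), Hi; simpl; ring.
Qed.

Lemma dd_gpw b : eq_on Om (dd b phi) (fun x y => (dd b P x y * phi x y)%C).
Proof.
intros x y H; apply is_dd_unique, is_dd_Cexp, (Cdiff_is_dd Om 0); auto.
apply Cinf_phase.
Qed.

Lemma T_dx_phase i j : (S i + j <= q + 1)%nat ->
  T G i j (dd true P) = (NtoC (S i) * lam (S i) j)%C.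
Proof.
intros H; rewrite (T_dx Om), T_phase; auto; apply Cinf_phase.
Qed.

Lemma T_dy_phase i j : (i + S j <= q + 1)%nat ->
  T G i j (dd false P) = (NtoC (S j) * lam i (S j))%C.
Proof.
intros H; rewrite (T_dy Om), T_phase; auto; apply Cinf_phase.
Qed.

(** [- Delta (exp P) + beta * exp P = gpw_residual * exp P]; the induction
    formula for the coefficients says that the residual vanishes to order
    [q - 1] at [G]. *)
Definition gpw_residual (x y : R) : C :=
  (beta x y + - RtoC 1 * (dd true (dd true P) x y + dd false (dd false P) x y
    + (dd true P x y * dd true P x y + dd false P x y * dd false P x y)))%C.

Lemma gpw_residual_flat : Cinf Om beta -> (1 <= q)%nat ->
  Cinf Om gpw_residual /\ flat G (q - 1) gpw_residual.
Proof.
intros Hb Hq; assert (HP := Cinf_phase).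
assert (Hx := Cinf_dd Om true _ HP); assert (Hy := Cinf_dd Om false _ HP).
assert (Hxx := Cinf_dd Om true _ Hx); assert (Hyy := Cinf_dd Om false _ Hy).
assert (Hlap := Cinf_plus Om Om_open _ _ Hxx Hyy).
assert (Hx2 := Cinf_mult Om Om_open _ _ Hx Hx).
assert (Hy2 := Cinf_mult Om Om_open _ _ Hy Hy).
assert (Hgrad := Cinf_plus Om Om_open _ _ Hx2 Hy2).
assert (Hsum := Cinf_plus Om Om_open _ _ Hlap Hgrad).
assert (Hsum' := Cinf_scal Om Om_open (- RtoC 1)%C _ Hsum).
assert (Hres : Cinf Om gpw_residual) by apply (Cinf_plus Om Om_open _ _ Hb Hsum').
split; auto; apply (T_flat Om Om_open G G_in); auto; intros i j Hij.
(* The coefficient (i, j) involves [lam] up to total order i + j + 2, at most q + 1, so nothing that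
   is truncated from [P] occurs. *)
unfold gpw_residual.
rewrite (T_plus Om Om_open G G_in _ _ _ _ Hb Hsum'),
  (T_scal Om Om_open G G_in _ _ _ _ Hsum),
  (T_plus Om Om_open G G_in _ _ _ _ Hlap Hgrad),
  (T_plus Om Om_open G G_in _ _ _ _ Hxx Hyy),
  (T_plus Om Om_open G G_in _ _ _ _ Hx2 Hy2),
  (T_mult Om Om_open G G_in _ _ _ _ Hx Hx),
  (T_mult Om Om_open G G_in _ _ _ _ Hy Hy),
  (T_dx Om Om_open G G_in _ _ _ Hx), (T_dy Om Om_open G G_in _ _ _ Hy),
  T_dx_phase, T_dy_phase by lia.
destruct (gpw_coeff_spec beta G N theta) as [_ [_ [_ Hstep]]].
assert (E := Hstep i j); fold lam in E.
replace (i + 2)%nat with (S (S i)) in E by lia.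
rewrite E; unfold gpw_step.
rewrite pderiv_DD, (T_DD Om Om_open G G_in i j beta Hb).
replace (j + 2)%nat with (S (S j)) by lia; replace (j + 1)%nat with (S j) by lia.
replace (i + 2)%nat with (S (S i)) by lia; replace (i + 1)%nat with (S i) by lia.
(* In its second double sum [gpw_step] has the y-index outside, while [T_mult] has it inside. *)
rewrite <- (sum_n_switch (G := C_AbelianMonoid) (fun l k =>
  (NtoC (j - k + 1) * NtoC (k + 1) * lam (i - l) (j - k + 1) * lam l (k + 1))%C)).
rewrite (Csum_ext _ (fun k => sum_n (fun l => (T G (i - k) (j - l) (dd true P)
  * T G k l (dd true P))%C) j)).
2: { intros k Hk; apply Csum_ext; intros l Hl; rewrite !T_dx_phase by lia.
     rewrite !Nat.add_1_r; ring. }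
rewrite (Csum_ext (fun l => sum_n (fun k => (NtoC (j - k + 1) * NtoC (k + 1)
  * lam (i - l) (j - k + 1) * lam l (k + 1))%C) j)
  (fun k => sum_n (fun l => (T G (i - k) (j - l) (dd false P)
  * T G k l (dd false P))%C) j)).
2: { intros k Hk; apply Csum_ext; intros l Hl; rewrite !T_dy_phase by lia.
     rewrite !Nat.add_1_r; ring. }
field; repeat split; apply NtoC_S_neq0 || apply NtoC_fact_neq0.
Qed.

Lemma lam_row01 i j : (i <= 1)%nat -> (1 < i + j)%nat -> lam i j = RtoC 0.
Proof. apply gpw_coeff_spec. Qed.

(** Rows 0 and 1 of [lam] contain only the linear terms. So on the line x = x_G both first
    derivatives of [P] are constant up to order [q] in y, and multiplication by them is scalar. *)
Lemma T_0_mult_phase j f : Cinf Om f -> (j <= q)%nat ->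
  T G 0 j (fun x y => (dd true P x y * f x y)%C) = (N * RtoC (cos theta) * T G 0 j f)%C /\
  T G 0 j (fun x y => (dd false P x y * f x y)%C) = (N * RtoC (sin theta) * T G 0 j f)%C.
Proof.
intros Hf Hj; assert (HP := Cinf_phase); split;
  rewrite (T_mult Om), sum_O, (Csum_single _ _ j); auto using Cinf_dd;
  simpl (0 - 0)%nat.
- rewrite Nat.sub_diag, T_dx_phase by lia.
  unfold lam; rewrite (proj1 (proj1 (gpw_coeff_spec _ _ _ _))).
  unfold NtoC; simpl INR; ring.
- intros k Hk Hkj; rewrite T_dx_phase, lam_row01 by lia; ring.
- rewrite Nat.sub_diag, T_dy_phase by lia.
  unfold lam; rewrite (proj2 (proj1 (gpw_coeff_spec _ _ _ _))).
  unfold NtoC; simpl INR; ring.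
- intros k Hk Hkj; rewrite T_dy_phase, lam_row01 by lia; ring.
Qed.

(** The wave equals 1 at [G] because lambda_{0,0} = 0. Then, by [dd_gpw], each y-derivative on the
    line x = x_G brings out a factor N sin theta. *)
Lemma DD_gpw_0 j : (j <= q)%nat ->
  DD 0 j phi (fst G) (snd G) = ((N * RtoC (sin theta)) ^ j)%C.
Proof.
assert (Hphi := Cinf_gpw).
intros Hj; rewrite (T_DD Om); auto.
induction j as [|j IH].
- unfold T, tay, NtoC; simpl; unfold phi, gpw.
  replace (gpw_phase beta G N theta q (fst G) (snd G)) with (RtoC 0).
  + unfold Cexp; simpl; rewrite exp_0, cos_0, sin_0; apply C_eq; simpl; field.
  + symmetry; assert (E := T_phase 0 0 (Nat.le_0_l _)).
    unfold T, tay, NtoC, P, lam in E; simpl in E.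
    rewrite (proj1 (proj2 (gpw_coeff_spec _ _ _ _))) in E; rewrite <- E.
    field; apply R1_neq_R0.
- assert (E := T_dy Om Om_open G G_in 0 j phi Hphi).
  rewrite (T_ext Om Om_open G G_in _ _ _ _ (dd_gpw false)) in E.
  rewrite (proj2 (T_0_mult_phase j phi Hphi ltac:(lia))) in E.
  rewrite NtoC_fact_S.
  transitivity (NtoC (fact 0) * NtoC (fact j) * (NtoC (S j) * T G 0 (S j) phi))%C;
    [ring|].
  rewrite <- E; simpl Cpow; rewrite <- IH by lia; ring.
Qed.

Lemma DD_gpw_1 j : (j <= q)%nat ->
  DD 1 j phi (fst G) (snd G)
  = (N * RtoC (cos theta) * (N * RtoC (sin theta)) ^ j)%C.
Proof.
assert (Hphi := Cinf_gpw).
intros Hj; rewrite <- DD_gpw_0 by auto; rewrite !(T_DD Om); auto.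
assert (E := T_dx Om Om_open G G_in 0 j phi Hphi).
rewrite (T_ext Om Om_open G G_in _ _ _ _ (dd_gpw true)) in E.
rewrite (proj1 (T_0_mult_phase j phi Hphi Hj)) in E.
replace (T G 1 j phi) with (NtoC 1 * T G 1 j phi)%C by (unfold NtoC; simpl; ring).
rewrite <- E; unfold NtoC; simpl; ring.
Qed.

Lemma gpw_equation_flat : Cinf Om beta -> (1 <= q)%nat ->
  flat G (q - 1) (fun x y =>
    (beta x y * phi x y + - RtoC 1 * (DD 2 0 phi x y + DD 0 2 phi x y))%C).
Proof.
intros Hb Hq; assert (HP := Cinf_phase).
destruct (gpw_residual_flat Hb Hq) as [Hres Hflat].
apply (flat_ext Om Om_open G G_in _ (fun x y => (gpw_residual x y * phi x y)%C)).
2: now apply (flat_mult Om Om_open G G_in); auto; apply Cinf_gpw.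
intros x y H.
assert (D2 : forall b, dd b (dd b phi) x y =
  ((dd b (dd b P) x y + dd b P x y * dd b P x y) * phi x y)%C).
{ intros b; rewrite (dd_ext Om Om_open b _ _ (dd_gpw b) x y H).
  rewrite (dd_mult Om), dd_gpw; auto; [ring|apply Cinf_dd, HP|apply Cinf_gpw]. }
unfold DD; simpl; rewrite !D2; unfold gpw_residual; ring.
Qed.

End GeneralizedPlaneWave.

(** * Approximation *)

Lemma Cmod_Csum (f : nat -> C) (g : nat -> R) n :
  (forall k, (k <= n)%nat -> Cmod (f k) <= g k) -> Cmod (sum_n f n) <= sum_n g n.
Proof.
induction n as [|n IH]; intros H.
- rewrite !sum_O; auto.
- rewrite !sum_Sn; apply Rle_trans with (1 := Cmod_triangle _ _).
  apply Rplus_le_compat; auto.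
Qed.

Lemma RtoC_pow x k : RtoC (x ^ k) = (RtoC x ^ k)%C.
Proof. induction k as [|k IH]; simpl; [easy|]; now rewrite RtoC_mult, IH. Qed.

Lemma RtoC_sum (f : nat -> R) n : RtoC (sum_n f n) = sum_n (fun k => RtoC (f k)) n.
Proof.
induction n as [|n IH]; [now rewrite !sum_O|]; rewrite !sum_Sn, <- IH; apply RtoC_plus.
Qed.

(** The moments are the derivatives at [G], with at most one x, of the combination of waves with
    weights [a]. The constant [A] is chosen before the moments, which makes the final constant
    independent of [u]. *)
Lemma moment_problem (n : nat) (N : C) : (1 <= n)%nat -> N <> RtoC 0 ->
  let s l := RtoC (sin (gpw_angle (2 * n + 1) (S l))) in
  let c l := RtoC (cos (gpw_angle (2 * n + 1) (S l))) in
  exists A, 0 <= A /\ forall m0 m1 : nat -> C, exists a : nat -> C,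
  (forall j, (j <= n)%nat -> sum_n (fun l => (a l * (N * s l) ^ j)%C) (2 * n) = m0 j) /\
  (forall j, (j < n)%nat ->
     sum_n (fun l => (a l * (N * c l * (N * s l) ^ j))%C) (2 * n) = m1 j) /\
  forall U, (forall j, (j <= n)%nat -> Cmod (m0 j) <= U) ->
    (forall j, (j < n)%nat -> Cmod (m1 j) <= U) ->
    forall l, (l <= 2 * n)%nat -> Cmod (a l) <= A * U.
Proof.
intros Hn HN s c.
destruct (TrigonometricInterpolation.trig_interpolation n Hn) as [E HE].
(* The power of [N] in the k-th moment: N cos (N sin)^(k - n - 1) contributes N^(k - n). *)
set (d k := if Nat.leb k n then (N ^ k)%C else (N ^ (k - n))%C).
assert (Hd : forall k, d k <> RtoC 0).
{ intros k; unfold d; destruct (Nat.leb k n); now apply Cpow_nz. }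
(* The weights are [E] applied to the rescaled moments, so a common bound of these absolute row sums
   serves as [A]. *)
destruct (finite_bound (fun l B =>
  sum_n (fun k => Rabs (E l k) * Cmod (/ d k)) (2 * n) <= B) (2 * n)) as [B HB].
{ intros; lra. }
{ intros l _; eexists; apply Rle_refl. }
assert (Hpos : forall l, 0 <= sum_n (fun k => Rabs (E l k) * Cmod (/ d k)) (2 * n)).
{ intros l; apply Rle_trans with (sum_n (fun _ => 0) (2 * n)).
  - rewrite sum_n_const; lra.
  - apply sum_n_m_le; intros k; apply Rmult_le_pos; auto using Rabs_pos, Cmod_ge_0. }
exists B; split.
{ apply Rle_trans with (2 := HB 0%nat (Nat.le_0_l _)), Hpos. }
intros m0 m1.
set (m k := if Nat.leb k n then m0 k else m1 (k - S n)%nat).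
set (a l := sum_n (fun k => (RtoC (E l k) * (m k / d k))%C) (2 * n)).
assert (Ha : forall j, (j <= 2 * n)%nat ->
  (d j * sum_n (fun l =>
    (a l * RtoC (trig_basis n j (gpw_angle (2 * n + 1) (S l))))%C) (2 * n))%C = m j).
{ intros j Hj.
  transitivity (d j * sum_n (fun k => m k / d k * RtoC (if Nat.eqb j k then 1 else 0))
    (2 * n))%C.
  - apply f_equal; unfold a.
    rewrite (Csum_ext _ (fun l => sum_n (fun k =>
      (m k / d k * RtoC (trig_basis n j (gpw_angle (2 * n + 1) (S l)) * E l k))%C)
      (2 * n))).
    + rewrite (sum_n_switch (G := C_AbelianMonoid)); apply Csum_ext; intros k Hk.
      now rewrite Csum_scal, <- RtoC_sum, HE.
    + intros l Hl; rewrite Cmult_comm, <- Csum_scal; apply Csum_ext; intros k Hk.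
      rewrite RtoC_mult; ring.
  - rewrite (Csum_single _ _ j); auto.
    + rewrite Nat.eqb_refl; field; auto.
    + intros k Hk Hjk; destruct (Nat.eqb_spec j k); [now subst|ring]. }
exists a; split; [|split].
- intros j Hj; assert (Hj' := Ha j ltac:(lia)).
  assert (L : Nat.leb j n = true) by now apply Nat.leb_le.
  unfold d, m, trig_basis in Hj'; rewrite L in Hj'; rewrite <- Hj', <- Csum_scal.
  apply Csum_ext; intros l _; rewrite RtoC_pow, Cpow_mult_l; unfold s; ring.
- intros j Hj; assert (Hj' := Ha (S n + j)%nat ltac:(lia)).
  assert (L : Nat.leb (S n + j) n = false) by (apply Nat.leb_gt; lia).
  unfold d, m, trig_basis in Hj'; rewrite L in Hj'.
  replace (S n + j - S n)%nat with j in Hj' by lia.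
  replace (S n + j - n)%nat with (S j) in Hj' by lia.
  rewrite <- Hj', <- Csum_scal.
  apply Csum_ext; intros l _; rewrite RtoC_mult, RtoC_pow, Cpow_mult_l; unfold s, c.
  simpl; ring.
- intros U H0 H1 l Hl.
  assert (HU : 0 <= U).
  { apply Rle_trans with (2 := H0 0%nat (Nat.le_0_l _)), Cmod_ge_0. }
  apply Rle_trans with (sum_n (fun k => Rabs (E l k) * Cmod (/ d k)) (2 * n) * U).
  + rewrite <- (sum_n_mult_r (K := R_Ring) U).
    apply Cmod_Csum; intros k Hk; unfold mult; simpl.
    unfold Cdiv; rewrite !Cmod_mult, Cmod_R, Rmult_assoc.
    apply Rmult_le_compat_l; [apply Rabs_pos|]; rewrite Rmult_comm.
    apply Rmult_le_compat_l; [apply Cmod_ge_0|].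
    unfold m; destruct (Nat.leb_spec k n); [now apply H0|apply H1; lia].
  + apply Rmult_le_compat_r; auto.
Qed.

(** The equation expresses the derivatives with at least two [x]'s through lower
    ones, so that a solution is determined to order [m] by its derivatives with
    at most one [x]. *)
Lemma flat_of_equation (Om : R * R -> Prop) (Om_open : open Om)
  G (G_in : Om G) beta w m :
  Cinf Om beta -> Cdiff Om m w ->
  (forall i j, (i + j + 2 <= m)%nat -> DD i j (fun x y =>
    (beta x y * w x y + - RtoC 1 * (DD 2 0 w x y + DD 0 2 w x y))%C)
    (fst G) (snd G) = RtoC 0) ->
  (forall i j, (i <= 1)%nat -> (i + j <= m)%nat -> DD i j w (fst G) (snd G) = RtoC 0) ->
  flat G m w.
Proof.
intros Hb Hw Heq H01.
assert (Gin := G_in' Om G G_in).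
assert (Main : forall k, (k <= m)%nat -> flat G k w); [|now apply Main].
induction k as [|k IHk]; intros Hk.
{ split; auto; apply (H01 0%nat 0%nat); lia. }
apply (flat_intro Om Om_open G G_in); [now apply (Cdiff_le _ _ m)|].
assert (Hflat : flat G k w) by (apply IHk; lia).
(* As [w] is flat to order [k], so is the contribution of beta w at the order needed, and the
   equation reduces at [G] to d_x^(i+2) d_y^j w = - d_x^i d_y^(j+2) w. *)
assert (Step : forall i j, (i + 2 + j = S k)%nat ->
  DD i (j + 2) w (fst G) (snd G) = RtoC 0 -> DD (i + 2) j w (fst G) (snd G) = RtoC 0).
{ intros i j Hij H2.
  assert (E := Heq i j ltac:(lia)).
  assert (C1 : Cdiff Om (i + j) (fun x y => (w x y * beta x y)%C)).
  { apply Cdiff_mult; auto; apply (Cdiff_le _ _ m); auto; lia. }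
  assert (C20 : Cdiff Om (i + j) (DD 2 0 w)).
  { apply Cdiff_DD, (Cdiff_le _ _ m); auto; lia. }
  assert (C02 : Cdiff Om (i + j) (DD 0 2 w)).
  { apply Cdiff_DD, (Cdiff_le _ _ m); auto; lia. }
  assert (C3 : Cdiff Om (i + j) (fun x y => (DD 2 0 w x y + DD 0 2 w x y)%C)).
  { now apply Cdiff_plus. }
  assert (C4 : Cdiff Om (i + j)
    (fun x y => (- RtoC 1 * (DD 2 0 w x y + DD 0 2 w x y))%C)).
  { apply Cdiff_mult; auto; now apply Cdiff_const. }
  assert (E' : (DD i j (fun x y => (w x y * beta x y)%C) (fst G) (snd G)
    + - RtoC 1 * (DD i j (DD 2 0 w) (fst G) (snd G)
                  + DD i j (DD 0 2 w) (fst G) (snd G)))%C = RtoC 0).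
  { rewrite <- E; symmetry; transitivity (DD i j (fun x y =>
      (w x y * beta x y + - RtoC 1 * (DD 2 0 w x y + DD 0 2 w x y))%C) (fst G) (snd G)).
    { apply (DD_ext Om Om_open); auto; intros x y _; ring. }
    etransitivity; [exact (DD_plus Om Om_open i j _ _ C1 C4 _ _ Gin)|]; apply f_equal.
    etransitivity; [exact (DD_scal Om Om_open i j _ _ C3 _ _ Gin)|]; apply f_equal.
    exact (DD_plus Om Om_open i j _ _ C20 C02 _ _ Gin). }
  clear E; rename E' into E.
  rewrite (flat_DD G (i + j)) in E; auto.
  2: { apply (flat_mult Om Om_open G G_in); auto.
       - apply (Cdiff_le _ _ m); auto; lia.
       - apply flat_le with (2 := Hflat); lia. }
  assert (E02 : DD i j (DD 0 2 w) (fst G) (snd G) = RtoC 0).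
  { rewrite <- H2; unfold DD; simpl (dit true 0 _); unfold dit; now rewrite Nat.iter_add. }
  assert (E20 : DD i j (DD 2 0 w) (fst G) (snd G) = DD (i + 2) j w (fst G) (snd G)).
  { replace (i + 2)%nat with (S (S i)) by lia; unfold DD at 2; simpl.
    assert (C5 : Cdiff Om (S (S j)) w) by (apply (Cdiff_le _ _ m); auto; lia).
    rewrite (DD_dd Om Om_open i j); auto; [|now apply Cdiff_dd].
    rewrite (DD_dd Om Om_open (S i) j); auto; now apply Cdiff_S. }
  rewrite E02, E20 in E.
  replace (DD (i + 2) j w (fst G) (snd G)) with
    (- (RtoC 0 + - RtoC 1 * (DD (i + 2) j w (fst G) (snd G) + RtoC 0)))%C by ring.
  rewrite E; ring. }
(* [Step] raises the x-order by two, so the induction carries two consecutive values of [i]. *)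
assert (Top : forall i, (forall j, (i + j = S k)%nat -> DD i j w (fst G) (snd G) = RtoC 0)
  /\ (forall j, (S i + j = S k)%nat -> DD (S i) j w (fst G) (snd G) = RtoC 0)).
{ induction i as [|i [IH1 IH2]].
  - split; intros j Hj; apply H01; lia.
  - split; auto; intros j Hj.
    replace (S (S i)) with (i + 2)%nat by lia; apply Step; [lia|apply IH1; lia]. }
intros i j Hij; destruct (Nat.eq_dec (i + j) (S k)) as [Hs|Hs].
- now apply (Top i).
- apply (flat_DD G k); auto; lia.
Qed.

(** A wave depends on [beta] only through derivatives at [G] and is smooth on the whole plane. Its
    derivatives are therefore bounded on a square containing the bounded set [Om], even up to the
    boundary of [Om]. *)
Lemma gpw_derivatives_bounded (Om : R * R -> Prop) (Om_bounded : bounded2 Om)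
  beta G N q (th : nat -> R) p m :
  exists B, 0 <= B /\ forall l i j x y, (l <= p)%nat -> (i + j <= m)%nat -> Om (x, y) ->
    Cmod (DD i j (gpw beta G N (th l) q) x y) <= B.
Proof.
destruct Om_bounded as [r Hr].
destruct (finite_bound (fun l B => forall i, (i <= m)%nat -> forall j, (j <= m)%nat ->
  forall x y, Om (x, y) -> Cmod (DD i j (gpw beta G N (th l) q) x y) <= B) p) as [B HB].
- intros l B B' HBB H i Hi j Hj x y Hxy; apply Rle_trans with (2 := HBB); auto.
- intros l _; apply finite_bound.
  { intros i B B' HBB H j Hj x y Hxy; apply Rle_trans with (2 := HBB); auto. }
  intros i _; apply finite_bound.
  { intros j B B' HBB H x y Hxy; apply Rle_trans with (2 := HBB); auto. }
  intros j _.
  destruct (Ccont_bounded (DD i j (gpw beta G N (th l) q)) 0 0 r) as [B HB].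
  + intros x y; apply (Cdiff_cont (fun _ => True) 0); auto.
    apply Cdiff_DD, (Cinf_gpw _
      (open_true (T := prod_UniformSpace R_UniformSpace R_UniformSpace))).
  + exists B; intros x y Hxy; apply HB; (apply Rle_trans with (2 := Hr _ Hxy)); simpl;
      unfold dist_euc; rewrite <- (sqrt_Rsqr (Rabs _)) by apply Rabs_pos;
      apply sqrt_le_1_alt; rewrite <- Rsqr_abs; unfold Rsqr; nra.
- exists (Rmax 0 B); split; [apply Rmax_l|]; intros l i j x y Hl Hij Hxy.
  apply Rle_trans with (2 := Rmax_r _ _); apply HB; auto; lia.
Qed.

Lemma max_dist_le_dist_euc G x y : max_dist G x y <= dist_euc x y (fst G) (snd G).
Proof.
unfold dist_euc; apply Rmax_lub; rewrite <- (sqrt_Rsqr (Rabs _)) by apply Rabs_pos;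
  apply sqrt_le_1_alt; rewrite <- Rsqr_abs;
  pose proof (Rle_0_sqr (x - fst G)); pose proof (Rle_0_sqr (y - snd G)); lra.
Qed.

Lemma max_dist_ge0 G x y : 0 <= max_dist G x y.
Proof. apply Rle_trans with (2 := Rmax_l _ _), Rabs_pos. Qed.

Lemma grad_dist_le f g x y :
  grad_dist f g x y <= Cmod (pderiv 1 0 f x y - pderiv 1 0 g x y)
                       + Cmod (pderiv 0 1 f x y - pderiv 0 1 g x y).
Proof.
unfold grad_dist.
set (a := Cmod _); set (b := Cmod (pderiv 0 1 f x y - _)).
assert (0 <= a) by apply Cmod_ge_0; assert (0 <= b) by apply Cmod_ge_0.
rewrite <- (sqrt_pow2 (a + b)) by lra.
apply sqrt_le_1_alt; nra.
Qed.

(** [flat_bound] near [G], and the bound [K] itself away from [G]. *)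
Lemma flat_bound_on (Om : R * R -> Prop) (Om_open : open Om) G r K m f :
  0 < r <= 1 -> (forall x y, max_dist G x y < r -> Om (x, y)) ->
  Cdiff Om m f -> (forall k, (k < m)%nat -> flat G k f) ->
  (forall i j x y, (i + j <= m)%nat -> Om (x, y) -> Cmod (DD i j f x y) <= K) ->
  forall x y, Om (x, y) ->
    Cmod (f x y) <= (4 / r) ^ m * dist_euc x y (fst G) (snd G) ^ m * K.
Proof.
intros Hr Hbox Hf Hflat HK x y Hxy.
assert (HK0 : 0 <= K).
{ apply Rle_trans with (2 := HK 0%nat 0%nat x y (Nat.le_0_l _) Hxy), Cmod_ge_0. }
assert (Hd := max_dist_le_dist_euc G x y); assert (Hd0 := max_dist_ge0 G x y).
(* With r at most 1, the factor 4 / r dominates the 4 of [flat_bound]; away from [G], 4 / r times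
   the distance is at least 1. *)
assert (Hr1 : 1 <= / r) by (rewrite <- Rinv_1; apply Rinv_le_contravar; lra).
destruct (Rlt_le_dec (max_dist G x y) r) as [H|H].
- apply Rle_trans with (4 ^ m * K * max_dist G x y ^ m).
  + apply (flat_bound Om Om_open G r); auto; intros; apply HK; auto; lia.
  + replace (_ * _ * K) with ((4 / r) ^ m * K * dist_euc x y (fst G) (snd G) ^ m) by ring.
    apply Rmult_le_compat.
    * apply Rmult_le_pos; auto; apply pow_le; lra.
    * apply pow_le; lra.
    * apply Rmult_le_compat_r; auto; apply pow_incr; unfold Rdiv; lra.
    * apply pow_incr; lra.
- apply Rle_trans with (1 * K).
  + rewrite Rmult_1_l; apply (HK 0%nat 0%nat); auto; lia.
  + apply Rmult_le_compat_r; auto; rewrite <- Rpow_mult_distr.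
    apply pow_R1_Rle.
    replace (4 / r * dist_euc x y (fst G) (snd G)) with
      (4 * (dist_euc x y (fst G) (snd G) / r)) by (field; lra).
    assert (1 <= dist_euc x y (fst G) (snd G) / r); [|lra].
    apply (Rmult_le_reg_r r); [lra|].
    unfold Rdiv; rewrite Rmult_assoc, Rinv_l by lra; lra.
Qed.

(** * The combination of waves matched to a solution *)

Section Approximation.

Variables (Om : R * R -> Prop) (Om_open : open Om) (Om_bounded : bounded2 Om).
Variables (beta : R -> R -> C) (beta_smooth : Cinf Om beta).
Variables (G : R * R) (G_in : Om G) (N : C) (N_neq0 : N <> RtoC 0).
Variables (n : nat) (n_ge1 : (1 <= n)%nat) (q : nat) (q_ge : (n + 1 <= q)%nat).

Let phi l := gpw_family beta G N (2 * n + 1) q (S l).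

Let Cinf_phi l : Cinf Om (phi l).
Proof. exact (Cinf_gpw Om Om_open beta G N _ q). Qed.

Definition gpw_sum (a : nat -> C) (x y : R) : C :=
  sum_n (fun l => (a l * phi l x y)%C) (2 * n).

Lemma gpw_sum_in_span a :
  in_span (2 * n + 1) (gpw_family beta G N (2 * n + 1) q) (gpw_sum a).
Proof.
exists (fun l => a (pred l)); intros x y; unfold gpw_sum, sum_n.
transitivity (sum_n_m (fun l =>
  (a (pred l) * gpw_family beta G N (2 * n + 1) q l x y)%C) 1 (S (2 * n))).
- now rewrite <- sum_n_m_S.
- now rewrite <- (Nat.add_1_r (2 * n)).
Qed.

Lemma Cinf_gpw_sum a : Cinf Om (gpw_sum a).
Proof.
apply (Cinf_sum Om Om_open (fun l x y => (a l * phi l x y)%C)).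
intros; apply Cinf_scal; auto.
Qed.

Lemma DD_gpw_sum a i j : eq_on Om (DD i j (gpw_sum a))
  (fun x y => sum_n (fun l => (a l * DD i j (phi l) x y)%C) (2 * n)).
Proof.
intros x y H; unfold gpw_sum.
rewrite (DD_sum Om Om_open i j (fun l x y => (a l * phi l x y)%C)); auto.
- apply Csum_ext; intros l _; apply (DD_scal Om Om_open); auto; apply Cinf_phi.
- intros; apply Cinf_scal; auto.
Qed.

Lemma DD_minus i j f g : Cdiff Om (i + j) f -> Cdiff Om (i + j) g ->
  eq_on Om (DD i j (fun x y => (f x y - g x y)%C))
    (fun x y => (DD i j f x y - DD i j g x y)%C).
Proof.
intros Hf Hg x y H.
transitivity (DD i j (fun x y => (f x y + - RtoC 1 * g x y)%C) x y).
{ apply (DD_ext Om Om_open); auto; intros s t _; ring. }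
assert (Hg' : Cdiff Om (i + j) (fun x y => (- RtoC 1 * g x y)%C)).
{ apply Cdiff_mult; auto; now apply Cdiff_const. }
etransitivity; [exact (DD_plus Om Om_open i j _ _ Hf Hg' x y H)|].
rewrite (DD_scal Om Om_open i j _ _ Hg x y H); unfold Cminus; ring.
Qed.

Lemma Cdiff_minus k f g : Cdiff Om k f -> Cdiff Om k g ->
  Cdiff Om k (fun x y => (f x y - g x y)%C).
Proof.
intros Hf Hg; apply (Cdiff_ext Om Om_open k (fun x y => (f x y + - RtoC 1 * g x y)%C)).
- intros x y _; ring.
- apply Cdiff_plus; auto; apply Cdiff_mult; auto; now apply Cdiff_const.
Qed.

Lemma gpw_sum_flat u a : Cdiff Om (n + 1) u ->
  (forall x y, Om (x, y) -> (- laplacian u x y + beta x y * u x y)%C = RtoC 0) ->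
  (forall i j, (i <= 1)%nat -> (i + j <= n)%nat ->
     DD i j (gpw_sum a) (fst G) (snd G) = DD i j u (fst G) (snd G)) ->
  flat G n (fun x y => (u x y - gpw_sum a x y)%C).
Proof.
intros Hu Heq Ha.
assert (Gin := G_in' Om G G_in); assert (q_ge1 : (1 <= q)%nat) by lia.
assert (Hw := Cdiff_minus _ _ _ Hu (Cinf_gpw_sum a (n + 1)%nat)).
apply (flat_of_equation Om Om_open G G_in beta); auto.
- apply (Cdiff_le _ _ (n + 1)%nat); auto; lia.
- intros i j Hij.
  (* The equation is exact for [u], so only the defects of the waves remain, and these are flat to
     order q - 1, which is at least [n]. *)
  rewrite (DD_ext Om Om_open i j _ (fun x y => sum_n (fun l => (- a l *
    (beta x y * phi l x y
     + - RtoC 1 * (DD 2 0 (phi l) x y + DD 0 2 (phi l) x y)))%C) (2 * n)));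
    auto.
  + assert (HL : forall l, Cinf Om (fun x y => (beta x y * phi l x y
      + - RtoC 1 * (DD 2 0 (phi l) x y + DD 0 2 (phi l) x y))%C)).
    { intros l; apply Cinf_plus; auto; [now apply Cinf_mult|apply Cinf_scal; auto].
      apply Cinf_plus; auto; intros k; apply Cdiff_DD, Cinf_phi. }
    etransitivity.
    * refine (DD_sum Om Om_open i j (fun l x y => (- a l * (beta x y * phi l x y
        + - RtoC 1 * (DD 2 0 (phi l) x y + DD 0 2 (phi l) x y)))%C) (2 * n) _ _ _ Gin).
      intros l _; apply Cinf_scal; auto.
    * apply Csum_0; intros l _.
      etransitivity; [exact (DD_scal Om Om_open i j _ _ (HL l _) _ _ Gin)|].
      rewrite (flat_DD G (q - 1)); [ring| |lia].
      exact (gpw_equation_flat Om Om_open beta G G_in N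
        (gpw_angle (2 * n + 1) (S l)) q beta_smooth q_ge1).
  + intros x y H.
    assert (E := Heq x y H); unfold laplacian in E; rewrite !pderiv_DD in E.
    rewrite !DD_minus, !DD_gpw_sum; auto; try apply Cinf_gpw_sum;
      try (apply (Cdiff_le _ _ (n + 1)%nat); auto; lia).
    transitivity (- (beta x y * gpw_sum a x y + - RtoC 1 *
      (sum_n (fun l => a l * DD 2 0 (phi l) x y) (2 * n)
       + sum_n (fun l => a l * DD 0 2 (phi l) x y) (2 * n))))%C.
    (* A zero is inserted so that the equation satisfied by [u] can be substituted for it. *)
    { match goal with |- _ = ?r => transitivity (RtoC 0 + r)%C; [|ring] end.
      rewrite <- E; ring. }
    unfold gpw_sum; rewrite <- Csum_plus, <- !Csum_scal, <- Csum_plus.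
    match goal with |- (- ?s)%C = _ => replace (- s)%C with (- RtoC 1 * s)%C by ring end.
    rewrite <- Csum_scal; apply Csum_ext; intros l _; ring.
- intros i j Hi Hij; rewrite DD_minus; auto.
  + rewrite Ha; auto; ring.
  + apply (Cdiff_le _ _ (n + 1)%nat); auto; lia.
  + apply Cinf_gpw_sum.
Qed.

(** The real [U] stands for the norm of [u], when it is finite. *)
Lemma gpw_approximation : exists K, 0 < K /\
  forall u, Cdiff Om (n + 1) u ->
  (forall x y, Om (x, y) -> (- laplacian u x y + beta x y * u x y)%C = RtoC 0) ->
  exists u_a, in_span (2 * n + 1) (gpw_family beta G N (2 * n + 1) q) u_a /\
    (u (fst G) (snd G) - u_a (fst G) (snd G))%C = RtoC 0 /\
    grad_dist u u_a (fst G) (snd G) <= 0 /\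
    forall U, (forall i j x y, (i + j <= n + 1)%nat -> Om (x, y) ->
                 Cmod (pderiv i j u x y) <= U) ->
    forall x y, Om (x, y) ->
      Cmod (u x y - u_a x y) <= K * dist_euc x y (fst G) (snd G) ^ (n + 1) * U /\
      grad_dist u u_a x y <= K * dist_euc x y (fst G) (snd G) ^ n * U.
Proof.
assert (Gin := G_in' Om G G_in).
destruct (moment_problem n N n_ge1 N_neq0) as [A [HA Hmom]].
destruct (gpw_derivatives_bounded Om Om_bounded beta G N q
  (fun l => gpw_angle (2 * n + 1) (S l)) (2 * n) (n + 1)) as [B [HB HBphi]].
assert (Hr : exists r, 0 < r <= 1 /\ forall x y, max_dist G x y < r -> Om (x, y)).
{ destruct (open_2d Om Om_open _ _ Gin) as [r Hr].
  exists (Rmin 1 r); split; [split|].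
  - apply Rmin_glb_lt; [lra|apply cond_pos].
  - apply Rmin_l.
  - intros x y H; apply Hr.
    + apply Rle_lt_trans with (1 := Rmax_l _ (Rabs (y - snd G))).
      apply Rlt_le_trans with (1 := H), Rmin_r.
    + apply Rle_lt_trans with (1 := Rmax_r (Rabs (x - fst G)) _).
      apply Rlt_le_trans with (1 := H), Rmin_r. }
destruct Hr as [r [Hr Hbox]].
(* Derivatives of [u - u_a] are at most U + (2 n + 1) (A U) B: the norm of [u], then 2 n + 1 weights
   times the bound on the waves. *)
set (K0 := 1 + INR (S (2 * n)) * (A * B)).
assert (HK0 : 1 <= K0).
{ assert (0 <= INR (S (2 * n)) * (A * B)); [|unfold K0; lra].
  apply Rmult_le_pos; [apply pos_INR|now apply Rmult_le_pos]. }
assert (H4 : 4 <= 4 / r).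
{ apply (Rmult_le_reg_r r); [lra|]; replace (4 / r * r) with 4 by (field; lra); lra. }
(* The gradient estimate uses only the power [n]; the spare factor 4 / r absorbs the sum of the two
   components. *)
exists ((4 / r) ^ (n + 1) * K0); split.
{ apply Rmult_lt_0_compat; [apply pow_lt|]; lra. }
intros u Hu Heq.
destruct (Hmom (fun j => DD 0 j u (fst G) (snd G)) (fun j => DD 1 j u (fst G) (snd G)))
  as [a [Ha0 [Ha1 Hbound]]].
assert (Hflat : flat G n (fun x y => (u x y - gpw_sum a x y)%C)).
{ apply gpw_sum_flat; auto; intros i j Hi Hij; rewrite DD_gpw_sum; auto.
  destruct i as [|[|i]]; [| |lia].
  - rewrite <- Ha0 by lia; apply Csum_ext; intros l _.
    apply f_equal, (DD_gpw_0 Om Om_open beta G G_in N (gpw_angle (2 * n + 1) (S l))); lia.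
  - rewrite <- Ha1 by lia; apply Csum_ext; intros l _.
    apply f_equal, (DD_gpw_1 Om Om_open beta G G_in N (gpw_angle (2 * n + 1) (S l))); lia. }
assert (Hw := Cdiff_minus _ _ _ Hu (Cinf_gpw_sum a (n + 1)%nat)).
assert (HDw : forall i j, (i + j <= n + 1)%nat ->
  eq_on Om (DD i j (fun x y => (u x y - gpw_sum a x y)%C))
    (fun x y => (DD i j u x y - DD i j (gpw_sum a) x y)%C)).
{ intros i j Hij; apply DD_minus; [|apply Cinf_gpw_sum].
  now apply (Cdiff_le _ _ (n + 1)%nat). }
set (w := fun x y => (u x y - gpw_sum a x y)%C) in *.
exists (gpw_sum a); split; [apply gpw_sum_in_span|].
split; [exact (flat_0 G n w Hflat)|]; split.
{ apply Rle_trans with (1 := grad_dist_le _ _ _ _); rewrite !pderiv_DD.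
  rewrite <- (HDw 1%nat 0%nat), <- (HDw 0%nat 1%nat) by (auto; lia).
  rewrite !(flat_DD G n) by (auto; lia); rewrite Cmod_0; lra. }
intros U HU.
assert (HU' : forall i j x y, (i + j <= n + 1)%nat -> Om (x, y) ->
  Cmod (DD i j u x y) <= U).
{ intros; rewrite <- pderiv_DD; auto. }
assert (HU0 : 0 <= U).
{ apply Rle_trans with (2 := HU' 0%nat 0%nat _ _ (Nat.le_0_l _) Gin), Cmod_ge_0. }
assert (Hdw : forall i j x y, (i + j <= n + 1)%nat -> Om (x, y) ->
  Cmod (DD i j w x y) <= K0 * U).
{ intros i j x y Hij H; rewrite HDw, DD_gpw_sum by auto.
  apply Rle_trans with (1 := Cmod_triangle _ _); rewrite Cmod_opp.
  assert (Hs : Cmod (sum_n (fun l => (a l * DD i j (phi l) x y)%C) (2 * n))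
    <= sum_n (fun _ => A * U * B) (2 * n)).
  { apply Cmod_Csum; intros l Hl; rewrite Cmod_mult.
    apply Rmult_le_compat; auto using Cmod_ge_0.
    - apply Hbound; auto; intros; apply HU'; auto; lia.
    - exact (HBphi l i j x y Hl Hij H). }
  rewrite sum_n_const in Hs.
  assert (Hu' := HU' i j x y Hij H); unfold K0.
  replace ((1 + INR (S (2 * n)) * (A * B)) * U) with
    (U + INR (S (2 * n)) * (A * U * B)) by ring.
  lra. }
intros x y Hxy.
assert (Hdist : 0 <= dist_euc x y (fst G) (snd G)) by apply sqrt_pos.
split.
- replace (_ * _ * U) with
    ((4 / r) ^ (n + 1) * dist_euc x y (fst G) (snd G) ^ (n + 1) * (K0 * U))
    by ring.
  apply (flat_bound_on Om Om_open G r (K0 * U) (n + 1) w); auto.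
  intros k Hk; apply flat_le with (2 := Hflat); lia.
(* Each first derivative of [w] is flat to order n - 1 and of class C^n, so [flat_bound_on] applies
   to it directly. *)
- assert (D : forall b, Cmod (dd b w x y)
    <= (4 / r) ^ n * dist_euc x y (fst G) (snd G) ^ n * (K0 * U)).
  { intros b; replace (n + 1)%nat with (S n) in * by lia.
    apply (flat_bound_on Om Om_open G r (K0 * U) n (dd b w)); auto.
    - now apply Cdiff_dd.
    - intros k Hk; assert (F : flat G (S k) w) by (apply flat_le with (2 := Hflat); lia).
      apply F.
    - intros i j s t Hij Hst; destruct b.
      + rewrite (DD_dd Om Om_open); auto; [apply Hdw; auto; lia|].
        apply (Cdiff_le _ _ (S n)); auto; lia.
      + unfold DD; rewrite <- dit_S_r; apply (Hdw i (S j)); auto; lia. }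
  apply Rle_trans with (1 := grad_dist_le _ _ _ _); rewrite !pderiv_DD.
  rewrite <- (HDw 1%nat 0%nat), <- (HDw 0%nat 1%nat) by (auto; lia).
  apply Rle_trans with (1 := Rplus_le_compat _ _ _ _ (D true) (D false)).
  set (z := (4 / r) ^ n * dist_euc x y (fst G) (snd G) ^ n * (K0 * U)).
  assert (Hz : 0 <= z).
  { apply Rmult_le_pos; [apply Rmult_le_pos; apply pow_le; lra|].
    apply Rmult_le_pos; lra. }
  replace ((4 / r) ^ (n + 1) * K0 * _ * U) with (4 / r * z)
    by (unfold z; rewrite pow_add; ring).
  nra.
Qed.

End Approximation.

Lemma Ck_norm_ub k (Om : R * R -> Prop) f i j x y : (i + j <= k)%nat -> Om (x, y) ->
  Rbar_le (Cmod (pderiv i j f x y)) (Ck_norm k Om f).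
Proof.
intros Hij Hxy; unfold Ck_norm.
apply (proj1 (Lub_Rbar_correct _)); now exists i, j, x, y.
Qed.

Theorem theorem1
  (Omega : R * R -> Prop) (Omega_open : open Omega)
  (Omega_bounded : bounded2 Omega)
  (beta : R -> R -> C) (beta_smooth : Cinf_on Omega beta)
  (G : R * R) (G_in : Omega G)
  (N : C) (N_neq0 : N <> RtoC 0)
  (n : nat) (n_ge1 : (1 <= n)%nat)
  (q : nat) (q_ge : (n + 1 <= q)%nat) :
  exists C_N_Omega : R,
  forall u : R -> R -> C,
    Ck_on (n + 1) Omega u ->
    (forall x y, Omega (x, y) ->
       (- laplacian u x y + beta x y * u x y)%C = RtoC 0) ->
  exists u_a : R -> R -> C,
    in_span (2 * n + 1) (gpw_family beta G N (2 * n + 1) q) u_a /\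
    forall x y, Omega (x, y) ->
      Rbar_le (Finite (Cmod (u x y - u_a x y)))
        (Rbar_mult
           (Finite (C_N_Omega * dist_euc x y (fst G) (snd G) ^ (n + 1)))
           (Ck_norm (n + 1) Omega u)) /\
      Rbar_le (Finite (grad_dist u u_a x y))
        (Rbar_mult
           (Finite (C_N_Omega * dist_euc x y (fst G) (snd G) ^ n))
           (Ck_norm (n + 1) Omega u)).
Proof.
assert (Hb : Cinf Omega beta) by (intros k; apply Ck_on_Cdiff, beta_smooth).
destruct (gpw_approximation Omega Omega_open Omega_bounded beta Hb G G_in N N_neq0
  n n_ge1 q q_ge) as [K [HK H]].
exists K; intros u Hu Heq.
destruct (H u (Ck_on_Cdiff _ _ _ Hu) Heq) as [u_a [Hspan [H0 [H1 HU]]]].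
exists u_a; split; auto; intros x y Hxy.
assert (Hub := fun i j s t => Ck_norm_ub (n + 1) Omega u i j s t).
destruct (Ck_norm (n + 1) Omega u) as [U| |] eqn:EU.
- apply (HU U); auto.
(* With an infinite norm the right side is [p_infty] away from [G]. At [G] the finite factor is 0
   since the exponent is positive, and [Rbar_mult] of 0 and [p_infty] is 0. *)
- assert (Hinf : forall v k, (1 <= k)%nat ->
    (dist_euc x y (fst G) (snd G) = 0 -> v <= 0) ->
    Rbar_le (Finite v)
      (Rbar_mult (Finite (K * dist_euc x y (fst G) (snd G) ^ k)) p_infty)).
  { intros v k Hk Hv; assert (Hd : 0 <= dist_euc x y (fst G) (snd G)) by apply sqrt_pos.
    destruct (Req_dec (dist_euc x y (fst G) (snd G)) 0) as [E|E].
    - rewrite E, pow_i, Rmult_0_r, Rbar_mult_0_l by lia; now apply Hv.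
    - replace (Rbar_mult _ _) with p_infty; [easy|].
      symmetry; apply is_Rbar_mult_unique, is_Rbar_mult_sym, is_Rbar_mult_p_infty_pos.
      apply Rmult_lt_0_compat; auto; apply pow_lt; lra. }
  assert (Hpt : dist_euc x y (fst G) (snd G) = 0 -> x = fst G /\ y = snd G).
  { intros E; assert (L := max_dist_le_dist_euc G x y); rewrite E in L.
    assert (Lx := Rle_trans _ _ _ (Rmax_l _ _) L).
    assert (Ly := Rle_trans _ _ _ (Rmax_r _ _) L).
    apply Rabs_le_between in Lx; apply Rabs_le_between in Ly; lra. }
  split; apply Hinf; try lia; intros E; destruct (Hpt E) as [-> ->]; auto.
  rewrite H0, Cmod_0; lra.
(* The norm is at least the modulus of [u] at a point, so it is not [m_infty]. *)
- destruct (Hub 0%nat 0%nat x y (Nat.le_0_l _) Hxy).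
Qed.
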